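(* Let $\{w_k\}$ be generated by the subsampled Newton iteration $w_{k+1}=w_k-\nabla^2F_{S_k}(w_k)^{-1}\nabla F_{X_k}(w_k)$ with unit steplength. Suppose Assumptions A1–A4 and B1 hold and that for all $k$: (i) $|X_k|\ge|X_0|\,\eta_k^{\,k}$, where $|X_0|\ge\left(\frac{6v\gamma M}{\bar\mu^2}\right)^2$, $\eta_k>\eta_{k-1}$, $\eta_k\to\infty$, and $\eta_1>1$; (ii) $|S_k|>|S_{k-1}|$, $\lim_{k\to\infty}|S_k|=\infty$, and $|S_0|\ge\left(\frac{4\sigma}{\bar\mu}\right)^2$. If $\|w_0-w^*\|\le\frac{\bar\mu}{3\gamma M}$, then $\mathbb{E}[\|w_k-w^*\|]\to0$ R-superlinearly, i.e., there is a positive sequence $\{\tau_k\}$ with $\mathbb{E}[\|w_k-w^*\|]\le\tau_k$ for all $k$ and $\tau_{k+1}/\tau_k\to0$.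
   Context: Setting: $P$ is a probability distribution on input–output pairs $(x,y)$, $F(w)=\int f(w;x,y)\,dP(x,y)$ for $w\in\mathbb{R}^d$. Sample points $(x^i,y^i)$ are drawn independently from $P$, $F_i(w)=f(w;x^i,y^i)$ (so $\nabla F_i$, $\nabla^2F_i$ are unbiased for $\nabla F$, $\nabla^2F$). For a finite index set $S$, $\nabla F_S(w)=\frac1{|S|}\sum_{i\in S}\nabla F_i(w)$, $\nabla^2F_S(w)=\frac1{|S|}\sum_{i\in S}\nabla^2F_i(w)$. The samples $X_k,S_k$ are index sets of independently drawn points, chosen independently of each other and of the past. $w^*$ is the unique minimizer of $F$. Assumption A1: $F$ is twice continuously differentiable; for every positive integer $\beta$ there are $0<\mu_\beta\le L_\beta$ with $\mu_\beta I\preceq\nabla^2F_S(w)\preceq L_\beta I$ for all $w$ and all $|S|=\beta$; constants $0<\bar\mu\le\mu_\beta$ and $L_\beta\le\bar L<\infty$ for all $\beta$; and $\mu I\preceq\nabla^2F(w)\preceq LI$ for all $w$. Assumption A2: $\operatorname{tr}(\operatorname{Cov}(\nabla F_i(w)))\le v^2$ for all $w$. Assumption A3: $\|\nabla^2F(w)-\nabla^2F(z)\|\le M\|w-z\|$ for all $w,z$. Assumption A4: $\|\mathbb{E}[(\nabla^2F_i(w)-\nabla^2F(w))^2]\|\le\sigma^2$ for all $w$. Assumption B1: there is $\gamma>0$ such that every iterate satisfies $\mathbb{E}[\|w_k-w^*\|^2]\le\gamma(\mathbb{E}[\|w_k-w^*\|])^2$. *)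

(* Defs.v *)
From HB Require Import structures.
From mathcomp Require Import all_boot all_order all_algebra.
From mathcomp Require Import all_classical all_reals all_analysis.
Set Implicit Arguments. Unset Strict Implicit. Unset Printing Implicit Defensive.
Import Order.TTheory GRing.Theory Num.Theory.
Import numFieldNormedType.Exports.
Local Open Scope classical_set_scope.
Local Open Scope ring_scope.

Definition dotv {R : realType} {d : nat} (u v : 'cV[R]_d) : R := (u^T *m v) 0 0.
Definition norm2 {R : realType} {d : nat} (v : 'cV[R]_d) : R := Num.sqrt (dotv v v).

Definition opnorm {R : realType} {d : nat} (A : 'M[R]_d) : R :=
  sup [set norm2 (A *m v) | v in [set v : 'cV[R]_d | norm2 v <= 1]].

Definition loewner_le {R : realType} {d : nat} (A B : 'M[R]_d) : Prop :=
  forall v : 'cV[R]_d, 0 <= dotv v ((B - A) *m v).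

Definition gradS {R : realType} {d : nat} {Z : Type}
  (g : 'cV[R]_d -> Z -> 'cV[R]_d) (n : nat) (zs : nat -> Z) (w : 'cV[R]_d)
  : 'cV[R]_d := (n%:R)^-1 *: \sum_(i < n) g w (zs i).
Definition hessS {R : realType} {d : nat} {Z : Type}
  (H : 'cV[R]_d -> Z -> 'M[R]_d) (n : nat) (zs : nat -> Z) (w : 'cV[R]_d)
  : 'M[R]_d := (n%:R)^-1 *: \sum_(i < n) H w (zs i).

(* The subsampled Newton iterates with unit steplength:
   w_{k+1} = w_k - (hess_{S_k}(w_k))^{-1} grad_{X_k}(w_k),
   where X_k consists of the points xiX k 0, ..., xiX k (nX k - 1) and
   S_k of the points xiS k 0, ..., xiS k (nS k - 1). *)
Fixpoint sn_iter {R : realType} {d : nat} {Z Omega : Type}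
  (g : 'cV[R]_d -> Z -> 'cV[R]_d) (H : 'cV[R]_d -> Z -> 'M[R]_d)
  (nX nS : nat -> nat) (xiX xiS : nat -> nat -> Omega -> Z) (w0 : 'cV[R]_d)
  (k : nat) (om : Omega) : 'cV[R]_d :=
  match k with
  | 0 => w0
  | k'.+1 =>
      let wk := sn_iter g H nX nS xiX xiS w0 k' om in
      wk - invmx (hessS H (nS k') (fun i => xiS k' i om) wk)
                 *m gradS g (nX k') (fun i => xiX k' i om) wk
  end.

Definition mutually_independent {dO dZ : measure_display} {R : realType}
  {Omega : measurableType dO} {Z : measurableType dZ} {I : eqType}
  (Pr : probability Omega R) (xi : I -> Omega -> Z) (V : set I) : Prop :=
  forall (J : seq I) (A : I -> set Z),
    uniq J -> (forall j, j \in J -> V j) -> (forall j, measurable (A j)) ->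
    Pr (\bigcap_(j in [set j | j \in J]) (xi j @^-1` A j)) =
    (\prod_(j <- J) Pr (xi j @^-1` A j))%E.

Definition trCov {dZ : measure_display} {R : realType} {d : nat}
  {Z : measurableType dZ} (P : probability Z R) (G : Z -> 'cV[R]_d) : \bar R :=
  (\sum_(j < d) \int[P]_z (((G z j 0 - \int[P]_y (G y j 0)) ^+ 2)%:E))%E.

Definition mexp {dZ : measure_display} {R : realType} {d : nat}
  {Z : measurableType dZ} (P : probability Z R) (A : Z -> 'M[R]_d) : 'M[R]_d :=
  \matrix_(i, j) (\int[P]_z (A z i j)).

(* Main.v *)
Require Import Defs.
From HB Require Import structures.
From mathcomp Require Import all_boot all_order all_algebra.
From mathcomp Require Import all_classical all_reals all_analysis.
From mathcomp Require Import measurable_realfun ring lra.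
Set Implicit Arguments. Unset Strict Implicit. Unset Printing Implicit Defensive.
Import Order.TTheory GRing.Theory Num.Theory.
Import numFieldNormedType.Exports.
Local Open Scope classical_set_scope.
Local Open Scope ring_scope.

(** Writing [u = w_k - w*] and [H_S], [g_X] for the sampled Hessian and gradient
    at [w_k], one has
      [w_{k+1} - w* = H_S^{-1} ((H_S - HF) u + (HF u - gF) + (gF - g_X))].
    The middle term is at most [M/2 |u|^2] by the Lipschitz Hessian.  The samples
    drawn at step [k] are independent of [w_k], so conditionally on [w_k] the two
    other terms are means of i.i.d. centred vectors, of expected norm at most
    [sigma |u| / sqrt |S_k|] and [v / sqrt |X_k|]; the first bound reads the
    assumption on [E (H_i - HF)^2] as a bound on [E |(H_i - HF) u|^2], which
    is legitimate because Hessians are symmetric.  Together with B1,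
    [a_k = E |w_k - w*|] satisfies [a_{k+1} <= A a_k^2 + s_k a_k + x_k] with
    [s_k -> 0], [x_k <= c eta_k^{-k/2}] and [A a_0 <= 1/6], [A c <= 1/12],
    [s_k <= 1/4], from which a superlinearly decaying majorant is built. *)

(** * Euclidean geometry *)

(** Most of the work lies in justifying the expectations. No conditional expectation appears: the
    identity of [Omega], read once as a map into [Omega] with the sigma-algebra of the past draws
    and once with that of the draws of the current sample, gives two independent random variables,
    and Tonelli integrates the second one out. This asks that [w_k] be measurable for the past
    alone, hence that gradients and Hessians be measurable at a random point. The gradient is
    continuous in [w] and measurable in the sample point, so rounding [w] works; the sampled Hessian
    comes with no continuity in [w] and is recovered as a limit of difference quotients of the
    gradient. Its symmetry is not contained in the Loewner bounds and is derived from second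
    differences of [f].

    The three thresholds meet in [1/6 + 1/4 + 1/2 = 11/12 < 1], which first gives a merely linear
    decay. The sampling noise is of order [eta_k^(-k/2)] while the majorant is kept above a multiple
    of [eta_k^(-k/4)], so their quotient vanishes and the decay becomes superlinear. *)

Section Vectors.
Context {R : realType} {d : nat}.
Implicit Types (u v w : 'cV[R]_d) (A B : 'M[R]_d) (a : R).

Lemma dotvE u v : dotv u v = \sum_i u i 0 * v i 0.
Proof. by rewrite /dotv mxE; apply: eq_bigr => i _; rewrite mxE. Qed.

Lemma dotvC u v : dotv u v = dotv v u.
Proof. by rewrite !dotvE; apply: eq_bigr => i _; rewrite mulrC. Qed.

Lemma dotvDr u v w : dotv u (v + w) = dotv u v + dotv u w.
Proof. by rewrite /dotv mulmxDr mxE. Qed.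

Lemma dotvZr a u v : dotv u (a *: v) = a * dotv u v.
Proof. by rewrite /dotv -scalemxAr mxE. Qed.

Lemma dotvNr u v : dotv u (- v) = - dotv u v.
Proof. by rewrite -scaleN1r dotvZr mulN1r. Qed.

Lemma dotvBr u v w : dotv u (v - w) = dotv u v - dotv u w.
Proof. by rewrite dotvDr dotvNr. Qed.

Lemma dotvDl u v w : dotv (u + v) w = dotv u w + dotv v w.
Proof. by rewrite dotvC dotvDr !(dotvC w). Qed.

Lemma dotvZl a u v : dotv (a *: u) v = a * dotv u v.
Proof. by rewrite dotvC dotvZr dotvC. Qed.

Lemma dotvNl u v : dotv (- u) v = - dotv u v.
Proof. by rewrite dotvC dotvNr dotvC. Qed.

Lemma dotvBl u v w : dotv (u - v) w = dotv u w - dotv v w.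
Proof. by rewrite dotvDl dotvNl. Qed.

Lemma dotv0r u : dotv u 0 = 0.
Proof. by rewrite -(scale0r 0) dotvZr mul0r. Qed.

Lemma dotv_mull A u v : dotv (A *m u) v = dotv u (A^T *m v).
Proof. by rewrite /dotv trmx_mul mulmxA. Qed.

Lemma dotvvE u : dotv u u = \sum_i u i 0 ^+ 2.
Proof. by rewrite dotvE; apply: eq_bigr => i _; rewrite expr2. Qed.

Lemma dotvv_ge0 u : 0 <= dotv u u.
Proof. by rewrite dotvvE; apply: sumr_ge0 => i _; exact: sqr_ge0. Qed.

Lemma dotvv_eq0 u : dotv u u = 0 -> u = 0.
Proof.
rewrite dotvvE => /eqP; rewrite psumr_eq0; last by move=> i _; exact: sqr_ge0.
move=> /allP u0; apply/matrixP => i j; rewrite (ord1 j) mxE.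
by have := u0 i (mem_index_enum _); rewrite /= sqrf_eq0 => /eqP.
Qed.

Lemma norm2_ge0 u : 0 <= norm2 u.
Proof. exact: sqrtr_ge0. Qed.

Lemma norm2_sqr u : norm2 u ^+ 2 = dotv u u.
Proof. by rewrite /norm2 sqr_sqrtr// dotvv_ge0. Qed.

Lemma norm2_eq0 u : norm2 u = 0 -> u = 0.
Proof. by move=> u0; apply: dotvv_eq0; rewrite -norm2_sqr u0 expr0n. Qed.

Lemma norm2_0 : norm2 (0 : 'cV[R]_d) = 0.
Proof. by rewrite /norm2 dotv0r sqrtr0. Qed.

Lemma norm2Z a u : norm2 (a *: u) = `|a| * norm2 u.
Proof.
by rewrite /norm2 dotvZl dotvZr mulrA -expr2 sqrtrM ?sqr_ge0// sqrtr_sqr.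
Qed.

Lemma norm2N u : norm2 (- u) = norm2 u.
Proof. by rewrite /norm2 dotvNl dotvNr opprK. Qed.

Lemma norm2B u v : norm2 (u - v) = norm2 (v - u).
Proof. by rewrite -norm2N opprB. Qed.

Lemma dotv_le u v : dotv u v <= norm2 u * norm2 v.
Proof.
have [u0|u0] := eqVneq (norm2 u) 0.
  by rewrite u0 mul0r (norm2_eq0 u0) dotvC dotv0r.
have [v0|v0] := eqVneq (norm2 v) 0.
  by rewrite v0 mulr0 (norm2_eq0 v0) dotv0r.
have up : 0 < norm2 u by rewrite lt_neqAle eq_sym u0 norm2_ge0.
have vp : 0 < norm2 v by rewrite lt_neqAle eq_sym v0 norm2_ge0.
have := dotvv_ge0 (norm2 v *: u - norm2 u *: v).
rewrite dotvBl !dotvBr !dotvZl !dotvZr -!norm2_sqr (dotvC v u) => h.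
have {}h : 0 <= 2 * (norm2 u * norm2 v) * (norm2 u * norm2 v - dotv u v) by lra.
by move: h; rewrite pmulr_rge0 ?subr_ge0// mulr_gt0// mulr_gt0.
Qed.

Lemma norm2D u v : norm2 (u + v) <= norm2 u + norm2 v.
Proof.
rewrite -(@ler_pXn2r _ 2) ?nnegrE ?addr_ge0 ?norm2_ge0//.
rewrite norm2_sqr dotvDl !dotvDr -!norm2_sqr (dotvC v u).
by have := dotv_le u v; lra.
Qed.

(* Testing against [e = u]: this reduces vector bounds to scalar ones. *)
Lemma norm2_le_dotv u a : 0 <= a ->
  (forall e, dotv e u <= norm2 e * a) -> norm2 u <= a.
Proof.
move=> a0 /(_ u); rewrite -norm2_sqr expr2.
have [->|u0] := eqVneq (norm2 u) 0; first by [].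
by rewrite ler_pM2l// lt_neqAle eq_sym u0 norm2_ge0.
Qed.

Lemma ler_coord_norm2 u i : `|u i 0| <= norm2 u.
Proof.
rewrite -(@ler_pXn2r _ 2) ?nnegrE ?norm2_ge0// norm2_sqr dotvvE real_normK ?num_real//.
by rewrite (bigD1 i)//= lerDl sumr_ge0// => j _; exact: sqr_ge0.
Qed.

Lemma norm2_le_sum u : norm2 u <= \sum_i `|u i 0|.
Proof.
have -> : u = \sum_i u i 0 *: delta_mx i 0.
  by rewrite {1}(matrix_sum_delta u); apply: eq_bigr => i _; rewrite big_ord1.
have aux I (s : seq I) (h : I -> 'cV[R]_d) :
    norm2 (\sum_(i <- s) h i) <= \sum_(i <- s) norm2 (h i).
  elim: s => [|x s ih]; first by rewrite !big_nil norm2_0.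
  by rewrite !big_cons (le_trans (norm2D _ _))// lerD2l.
apply: le_trans (aux _ _ _) _; apply: ler_sum => i _.
rewrite norm2Z summxE (bigD1 i)//= big1 ?addr0; last first.
  by move=> j ji; rewrite !mxE eq_sym (negPf ji) mulr0.
rewrite !mxE !eqxx mulr1 /norm2 dotvvE (bigD1 i)//= big1 ?addr0; last first.
  by move=> j ji; rewrite !mxE (negPf ji) expr0n.
by rewrite !mxE !eqxx expr1n sqrtr1 mulr1.
Qed.

(** [sup] takes a default value on unbounded sets, so every estimate through [opnorm] rests on this
    bound. *)
Lemma opnorm_has_ubound A :
  has_ubound [set norm2 (A *m v) | v in [set v : 'cV[R]_d | norm2 v <= 1]].
Proof.
exists (\sum_i \sum_j `|A i j|) => _ [v /= v1 <-].
apply: le_trans (norm2_le_sum _) _; apply: ler_sum => i _.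
rewrite mxE; apply: le_trans (ler_norm_sum _ _ _) _; apply: ler_sum => j _.
rewrite normrM ler_piMr// (le_trans (ler_coord_norm2 _ _))//.
Qed.

Lemma norm2_mul_le A v : norm2 (A *m v) <= opnorm A * norm2 v.
Proof.
have [v0|v0] := eqVneq (norm2 v) 0.
  by rewrite v0 mulr0 (norm2_eq0 v0) mulmx0 norm2_0.
have vp : 0 < norm2 v by rewrite lt_neqAle eq_sym v0 norm2_ge0.
rewrite -ler_pdivrMr// mulrC.
have -> : (norm2 v)^-1 * norm2 (A *m v) = norm2 (A *m ((norm2 v)^-1 *: v)).
  by rewrite -scalemxAr norm2Z ger0_norm// invr_ge0 ltW.
apply: ub_le_sup; first exact: opnorm_has_ubound.
exists ((norm2 v)^-1 *: v); last by [].
by rewrite /= norm2Z ger0_norm ?invr_ge0 ?(ltW vp)// mulVf.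
Qed.

Lemma opnorm_ge0 A : 0 <= opnorm A.
Proof.
apply: ub_le_sup; first exact: opnorm_has_ubound.
by exists 0; [rewrite /= norm2_0 | rewrite mulmx0 norm2_0].
Qed.

Lemma dotv_mul_le A u v : dotv u (A *m v) <= opnorm A * norm2 u * norm2 v.
Proof.
rewrite mulrAC mulrC; apply: le_trans (dotv_le _ _) _.
by rewrite ler_wpM2l ?norm2_ge0 ?norm2_mul_le.
Qed.

Lemma loewner_scalar_le a A v : loewner_le (a *: 1%:M) A ->
  a * norm2 v ^+ 2 <= dotv v (A *m v).
Proof.
move=> /(_ v); rewrite mulmxBl -scalemxAl mul1mx dotvBr dotvZr subr_ge0.
by rewrite norm2_sqr.
Qed.

Lemma loewner_scalar_ge a A v : loewner_le A (a *: 1%:M) ->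
  dotv v (A *m v) <= a * norm2 v ^+ 2.
Proof.
move=> /(_ v); rewrite mulmxBl -scalemxAl mul1mx dotvBr dotvZr subr_ge0.
by rewrite norm2_sqr.
Qed.

Lemma loewner_norm2_ge a A v : loewner_le (a *: 1%:M) A ->
  a * norm2 v <= norm2 (A *m v).
Proof.
move=> /(loewner_scalar_le v) aA.
have [->|v0] := eqVneq (norm2 v) 0; first by rewrite mulr0 norm2_ge0.
have vp : 0 < norm2 v by rewrite lt_neqAle eq_sym v0 norm2_ge0.
rewrite -(ler_pM2l vp); apply: le_trans (dotv_le _ _).
by rewrite mulrCA -expr2.
Qed.

(** Coercivity gives [a * norm2 v <= norm2 (A *m v)], which leaves no kernel. [kermx] consists of
    row vectors, hence the passage through [A^T]. *)
Lemma loewner_unitmx a A : 0 < a -> loewner_le (a *: 1%:M) A -> A \in unitmx.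
Proof.
move=> a0 aA; rewrite -unitmx_tr -row_free_unit -kermx_eq0.
apply/eqP/row_matrixP => i; rewrite row0.
have /sub_kermxP ker : (row i (kermx A^T) <= kermx A^T)%MS by exact: row_sub.
set x := row i _ in ker *.
have Ax : A *m x^T = 0 by rewrite -[A]trmxK -trmx_mul ker trmx0.
have := loewner_norm2_ge x^T aA; rewrite Ax norm2_0 pmulr_rle0// => x0.
have /norm2_eq0 xT : norm2 x^T = 0 by apply/eqP; rewrite eq_le x0 norm2_ge0.
by rewrite -[x]trmxK xT trmx0.
Qed.

Lemma loewner_invmx_le a A v : 0 < a -> loewner_le (a *: 1%:M) A ->
  norm2 (invmx A *m v) <= a^-1 * norm2 v.
Proof.
move=> a0 aA; rewrite ler_pdivlMl//.
have uA := loewner_unitmx a0 aA.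
by have := loewner_norm2_ge (invmx A *m v) aA; rewrite mulmxA mulmxV// mul1mx.
Qed.

End Vectors.

(** * Directional derivatives and Hessians *)

Section DirectionalDerivatives.
Context {R : realType}.

Lemma is_derive_cvgP (V W : normedModType R) (f : V -> W) (a v : V) (l : W) :
  is_derive a v f l <-> h^-1 *: (f (h *: v + a) - f a) @[h --> 0^'] --> l.
Proof.
split => [[df dfE]|fl]; first by rewrite -dfE; exact: df.
by apply: DeriveDef; [exact: (cvgP l) | exact: cvg_lim].
Qed.

(** Reduces several variables to one: the mean value arguments below all run along such lines. *)
Lemma is_derive_line (V W : normedModType R) (f : V -> W) (w u : V) (t : R) (l : W) :
  is_derive (w + t *: u) u f l -> is_derive t 1 (fun s => f (w + s *: u)) l.
Proof.
move=> /is_derive_cvgP fl; apply/is_derive_cvgP; apply: cvg_trans fl.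
apply: near_eq_cvg; near=> h.
congr (_ *: (f _ - _)).
by rewrite [h *: (1 : R^o)]mulr1 scalerDl addrCA addrA.
Unshelve. all: end_near. Qed.

Lemma dotv_continuous d (e : 'cV[R]_d) : continuous (dotv e).
Proof.
rewrite (_ : dotv e = fun y => \sum_i e i 0 * y i 0); last first.
  by apply/funext => y; rewrite dotvE.
elim: (index_enum _) => [|i s ih] x.
  by rewrite (_ : (fun _ => _) = cst 0); [exact: cst_continuous|apply/funext => y; rewrite big_nil].
rewrite (_ : (fun _ => _) = (fun y : 'cV[R]_d => e i 0 * y i 0) \+
    (fun y : 'cV[R]_d => \sum_(i <- s) e i 0 * y i 0)); last first.
  by apply/funext => y; rewrite big_cons.
apply: continuousD; last exact: ih.
by apply: continuousM; [exact: cst_continuous | exact: coord_continuous].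
Qed.

Lemma is_derive_dotv (V : normedModType R) d (e : 'cV[R]_d) (G : V -> 'cV[R]_d)
    (t v : V) (l : 'cV[R]_d) :
  is_derive t v G l -> is_derive t v (fun s => dotv e (G s)) (dotv e l).
Proof.
move=> /is_derive_cvgP Gl; apply/is_derive_cvgP.
have /(_ _) := continuous_cvg _ (@dotv_continuous _ e l) Gl.
apply: cvg_trans; apply: near_eq_cvg; near=> h.
by rewrite /= dotvZr dotvBr.
Unshelve. all: end_near. Qed.

Lemma is_derive_within_continuous (f : R -> R) (df : R -> R) a b :
  (forall x : R, is_derive x 1 f (df x)) -> {within `[a, b], continuous f}.
Proof.
move=> fdf; apply: derivable_within_continuous => x _.
by case: (fdf x).
Qed.

Lemma MVT_everywhere (f : R -> R) (df : R -> R) a b : a < b ->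
  (forall x : R, is_derive x 1 f (df x)) ->
  exists2 c, a < c < b & f b - f a = df c * (b - a).
Proof.
move=> ab fdf.
have [c cab E] := MVT ab (fun x _ => fdf x) (is_derive_within_continuous fdf).
by exists c => //; move: cab; rewrite in_itv.
Qed.

End DirectionalDerivatives.

(** * Symmetry of the second derivative at a point where the gradient is differentiable *)

Section Schwarz.
Context {R : realType} {d : nat}.
Variables (f : 'cV[R]_d -> R) (g : 'cV[R]_d -> 'cV[R]_d) (H : 'M[R]_d).
Variable w : 'cV[R]_d.
Hypothesis fg : forall x u : 'cV[R]_d, is_derive x u f (dotv (g x) u).
Hypothesis dg : differentiable g w.
Hypothesis gH : forall u : 'cV[R]_d, is_derive w u g (H *m u).

Let second_difference (u v : 'cV[R]_d) (t : R) : R :=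
  f (w + t *: u + t *: v) - f (w + t *: u) - f (w + t *: v) + f w.

(** The norm carried by matrices is the largest entry, not [norm2], and differentiability is
    expressed in it; this is the matching Hölder inequality. *)
Lemma dotv_le_mx_norm (x u : 'cV[R]_d) : `|dotv x u| <= `|x| * \sum_i `|u i 0|.
Proof.
rewrite dotvE mulr_sumr; apply: le_trans (ler_norm_sum _ _ _) _.
apply: ler_sum => i _; rewrite normrM ler_wpM2r//.
rewrite [leRHS]/Num.norm /= mx_normrE; apply/bigmax_geP; right => /=.
by exists (i, 0).
Qed.

Lemma gradient_remainder u (e : R) : 0 < e -> exists2 dl : R, 0 < dl &
  forall k : 'cV[R]_d, `|k| < dl ->
  `|dotv (g (w + k) - g w - H *m k) u| <= e * `|k|.
Proof.
move=> e0; pose c : R := 1 + \sum_i `|u i 0|.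
have c0 : 0 < c by rewrite ltr_pwDl// sumr_ge0.
have := diff_locally dg; move/eqaddoP/(_ (e / c)).
move=> /(_ (divr_gt0 e0 c0)) /nbhs_ballP[dl /= dl0 near_dl].
exists dl => // k kdl.
have := near_dl k; rewrite -ball_normE /= sub0r normrN => /(_ kdl).
rewrite /= !fctE (addrC k).
have -> : 'd g w k = H *m k.
  by rewrite -deriveE//; case: (gH k).
rewrite opprD addrA => gk.
apply: le_trans (dotv_le_mx_norm _ _) _.
apply: le_trans (_ : (e / c * `|k|) * c <= _); last by rewrite mulrAC divfK// gt_eqF.
apply: ler_pM => //; first by rewrite sumr_ge0.
by rewrite /c lerDr.
Qed.

(** The mean value theorem in the direction [u] turns the second difference into [t] times a
    difference of gradients at two points near [w]. Expanding both gradients at [w], the parts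
    linear in [s *: u] cancel and [t * (H v)] remains. *)
Lemma second_difference_approx (u v : 'cV[R]_d) (e : R) : 0 < e -> exists2 dl : R, 0 < dl &
  forall t : R, 0 < t < dl ->
  `|second_difference u v t - t ^+ 2 * dotv (H *m v) u| <= e * t ^+ 2.
Proof.
(* The two increments [s *: u] and [t *: v + s *: u] have total length at most [t * (2|u| + |v|)];
   the [1] keeps [c] positive. *)
move=> e0; pose c : R := 2 * `|u| + `|v| + 1.
have c0 : 0 < c by rewrite ltr_wpDl// addr_ge0// mulr_ge0.
have [dl dl0 rem] := gradient_remainder u (divr_gt0 e0 c0).
exists (dl / c); first exact: divr_gt0.
move=> t /andP[t0 tdl].
pose phi (s : R) : R := f (w + t *: v + s *: u) - f (w + s *: u).
pose dphi (s : R) : R := dotv (g (w + t *: v + s *: u)) u - dotv (g (w + s *: u)) u.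
have dphiE (s : R) : is_derive s 1 phi (dphi s).
  by apply: is_deriveB; apply: is_derive_line; exact: fg.
have [s /andP[s0 st]] := MVT_everywhere t0 dphiE.
rewrite subr0 /phi scale0r !addr0 => E.
have -> : second_difference u v t = dphi s * t.
  by rewrite -E /second_difference [w + t *: u + t *: v]addrAC; ring.
have k1 : `|s *: u| <= t * `|u|.
  by rewrite normrZ gtr0_norm// ler_wpM2r// ltW.
have k2 : `|t *: v + s *: u| <= t * (`|u| + `|v|).
  rewrite (le_trans (ler_normD _ _))// mulrDr addrC lerD//.
  by rewrite normrZ gtr0_norm.
have tc : t * c < dl by rewrite -ltr_pdivlMr.
have u0 : 0 <= `|u| by []. have v0 : 0 <= `|v| by [].
have /rem r1 : `|s *: u| < dl.
  by apply: le_lt_trans k1 _; apply: le_lt_trans tc; rewrite ler_pM2l// /c; lra.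
have /rem r2 : `|t *: v + s *: u| < dl.
  by apply: le_lt_trans k2 _; apply: le_lt_trans tc; rewrite ler_pM2l// /c; lra.
have -> : dphi s * t - t ^+ 2 * dotv (H *m v) u =
   t * (dotv (g (w + (t *: v + s *: u)) - g w - H *m (t *: v + s *: u)) u -
        dotv (g (w + s *: u) - g w - H *m (s *: u)) u).
  rewrite /dphi !dotvBl mulmxDr dotvDl -!scalemxAr !dotvZl addrA; ring.
rewrite normrM gtr0_norm// expr2 mulrCA ler_pM2l//.
apply: le_trans (ler_normB _ _) _; apply: le_trans (lerD r2 r1) _.
rewrite -mulrDr -mulrA ler_pM2l// ler_pdivrMl//.
apply: le_trans (lerD k2 k1) _; rewrite -mulrDr mulrC ler_pM2r// /c; lra.
Qed.

(** The second difference is symmetric in [u] and [v], so its two approximations force the bilinear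
    form to be symmetric up to every [e]; basis vectors then give the entries. *)
Lemma hessian_sym : H^T = H.
Proof.
have sym u v : dotv (H *m v) u = dotv (H *m u) v.
  apply/eqP; rewrite -subr_eq0 -normr_le0; apply/ler_addgt0Pr => e e0.
  rewrite add0r.
  have e2 : 0 < e / 2 by rewrite divr_gt0.
  have [d1 d10 h1] := second_difference_approx u v e2.
  have [d2 d20 h2] := second_difference_approx v u e2.
  pose t : R := Num.min d1 d2 / 2.
  have m0 : 0 < Num.min d1 d2 by rewrite lt_min d10.
  have t0 : 0 < t by rewrite divr_gt0.
  have tm : t < Num.min d1 d2 by rewrite ltr_pdivrMr// mulr_natr mulr2n ltrDl.
  have /h1 {}h1 : 0 < t < d1 by rewrite t0; move: tm; rewrite lt_min => /andP[].
  have /h2 {}h2 : 0 < t < d2 by rewrite t0; move: tm; rewrite lt_min => /andP[].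
  have E : second_difference v u t = second_difference u v t.
    by rewrite /second_difference [w + t *: v + _]addrAC; ring.
  rewrite E distrC in h2.
  have tt : 0 < t ^+ 2 by rewrite exprn_gt0.
  rewrite -(ler_pM2l tt) -{1}(gtr0_norm tt) -normrM.
  apply: le_trans (_ : e / 2 * t ^+ 2 + e / 2 * t ^+ 2 <= _); last by lra.
  apply: le_trans (lerD h1 h2); rewrite -[X in _ <= X]addrC.
  apply: le_trans (ler_normD _ _).
  by rewrite le_eqVlt; apply/orP; left; rewrite -normrN; apply/eqP; congr `| _ |; ring.
apply/matrixP => i j; rewrite mxE.
have := sym (delta_mx j 0) (delta_mx i 0).
have col (k l : 'I_d) : dotv (H *m delta_mx k 0) (delta_mx l 0) = H l k.
  rewrite -colE dotvE (bigD1 l)//= big1 ?addr0; last first.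
    by move=> m ml; rewrite !mxE (negPf ml) mulr0.
  by rewrite !mxE !eqxx mulr1.
by rewrite !col.
Qed.

End Schwarz.

(** * Stationarity of a minimizer and a first-order estimate of the gradient *)

Section SmoothMinimization.
Context {R : realType} {d : nat}.

(** Along the direction of the gradient itself, the derivative at the minimum is the squared norm of
    the gradient. *)
Lemma gradient_at_min (F : 'cV[R]_d -> R) (gF : 'cV[R]_d -> 'cV[R]_d) (ws : 'cV[R]_d) :
  (forall w u : 'cV[R]_d, is_derive w u F (dotv (gF w) u)) ->
  (forall w, F ws <= F w) -> gF ws = 0.
Proof.
move=> dF Fmin; apply: dotvv_eq0; set u := gF ws.
have dphi (t : R) : is_derive t 1 (fun s => F (ws + s *: u)) (dotv (gF (ws + t *: u)) u).
  by apply: is_derive_line; exact: dF.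
have [|t _||t _|_] := @derive1_at_min R (fun s => F (ws + s *: u)) (-1) 1 0.
- by lra.
- by case: (dphi t).
- by rewrite in_itv /= ltrN10 ltr01.
- by rewrite scale0r addr0; exact: Fmin.
by case: (dphi 0) => _ ->; rewrite scale0r addr0.
Qed.

Lemma gradient_taylor_le (gF : 'cV[R]_d -> 'cV[R]_d) (HF : 'cV[R]_d -> 'M[R]_d)
    (M : R) (w z : 'cV[R]_d) :
  (forall w u : 'cV[R]_d, is_derive w u gF (HF w *m u)) ->
  (forall w z, opnorm (HF w - HF z) <= M * norm2 (w - z)) ->
  norm2 (HF w *m (w - z) - (gF w - gF z)) <= M / 2 * norm2 (w - z) ^+ 2.
Proof.
move=> dgF lip; set u := w - z.
have [u0|u0] := eqVneq (norm2 u) 0.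
  have wz : w = z by apply/eqP; rewrite -subr_eq0; apply/eqP; exact: norm2_eq0.
  by rewrite (norm2_eq0 u0) {1}wz mulmx0 wz !subrr norm2_0 expr0n mulr0.
have up : 0 < norm2 u by rewrite lt_neqAle eq_sym u0 norm2_ge0.
(* The sign of [M] is read off the Lipschitz bound between [w] and [z], which needs [u] nonzero. *)
have M0 : 0 <= M by rewrite -(pmulr_lge0 _ up) (le_trans (opnorm_ge0 _) (lip _ _)).
rewrite norm2B; apply: norm2_le_dotv => [|e].
  by rewrite mulr_ge0 ?divr_ge0 ?exprn_ge0 ?norm2_ge0.
pose K := M * norm2 e * norm2 u ^+ 2; pose b := dotv e (HF w *m u).
(* Replaces integration along the segment: the points [z + t u] and [w] differ by [(1 - t) u], so
   the Hessian error is at most [K (1 - t)]. The terms in [K] are minus a primitive of this bound,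
   so [psi] does not increase on the segment, and [psi 1 <= psi 0] yields the factor [1/2]. *)
pose psi (t : R) : R := dotv e (gF (z + t *: u)) - (b + K) * t + K / 2 * t ^+ 2.
pose dpsi (t : R) : R := dotv e (HF (z + t *: u) *m u) - (b + K) + K * t.
have dpsiE (t : R) : is_derive t 1 psi (dpsi t).
  have ? : is_derive t 1 (fun s => dotv e (gF (z + s *: u))) (dotv e (HF (z + t *: u) *m u)).
    by apply: is_derive_dotv; apply: is_derive_line; exact: dgF.
  rewrite /psi; apply: is_derive_eq.
  rewrite /dpsi /GRing.scale /=; lra.
have [c /andP[c0 c1]] := MVT_everywhere ltr01 dpsiE.
rewrite subr0 mulr1 => E.
have zu : z + u = w by rewrite addrC subrK.
have : dpsi c <= 0.
  rewrite /dpsi; have -> : dotv e (HF (z + c *: u) *m u) - (b + K) + K * c =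
    dotv e ((HF (z + c *: u) - HF w) *m u) - K * (1 - c).
    by rewrite mulmxBl dotvBr /b; ring.
  rewrite subr_le0; apply: le_trans (dotv_mul_le _ _ _) _.
  have -> : K * (1 - c) = M * ((1 - c) * norm2 u) * norm2 e * norm2 u by rewrite /K; ring.
  do 2 (apply: ler_wpM2r; first exact: norm2_ge0).
  apply: le_trans (lip _ _) _; rewrite ler_wpM2l//.
  have -> : z + c *: u - w = - ((1 - c) *: u).
    by rewrite -zu scalerBl scale1r; apply/matrixP => i j; rewrite !mxE; ring.
  by rewrite norm2N norm2Z gtr0_norm// subr_gt0.
rewrite -E /psi scale1r scale0r addr0 zu /b /K => h.
have -> : dotv e (gF w - gF z - HF w *m u) = dotv e (gF w) - dotv e (gF z) - dotv e (HF w *m u).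
  by rewrite !dotvBr.
by lra.
Qed.

End SmoothMinimization.

(** * Measurability of the iterates *)

Section Measurability.
Context {R : realType} {dT : measure_display} {T : measurableType dT}.

Lemma measurable_fun_countable_index (C : countType) (c : T -> C)
    (psi : C -> T -> R) :
  (forall q, measurable (c @^-1` [set q])) ->
  (forall q, measurable_fun setT (psi q)) ->
  measurable_fun setT (fun t => psi (c t) t).
Proof.
move=> mc mpsi _ B mB; rewrite setTI.
rewrite (_ : _ @^-1` B = \bigcup_q (c @^-1` [set q] `&` psi q @^-1` B)).
  apply: countable_bigcupT_measurable => [|q]; first exact: countableP.
  by apply: measurableI; [exact: mc | rewrite -[X in measurable X]setTI; exact: mpsi].
by apply/seteqP; split=> [t Bt|t [q _ [/= <-]]//]; exists (c t).
Qed.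

(* Round [w] down to the grid of mesh [1 / n.+1], which takes countably many
   values, and let [n] go to infinity. *)
Lemma measurable_fun_caratheodory d (w : T -> 'cV[R]_d) (phi : 'cV[R]_d -> T -> R) :
  (forall i, measurable_fun setT (fun t => w t i 0)) ->
  (forall q, measurable_fun setT (phi q)) ->
  (forall t, continuous (phi^~ t)) ->
  measurable_fun setT (fun t => phi (w t) t).
Proof.
move=> mw mphi cphi.
pose idx n t : 'cV[int]_d := \col_i Num.floor (n.+1%:R * w t i 0).
pose grid n (q : 'cV[int]_d) : 'cV[R]_d := \col_i (n.+1%:R^-1 * (q i 0)%:~R).
apply: (@measurable_fun_cvg _ _ _ _ (fun n t => phi (grid n (idx n t)) t)).
  move=> n; apply: (@measurable_fun_countable_index _ (idx n) (fun q => phi (grid n q))) => // q.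
  rewrite (_ : _ @^-1` _ = \bigcap_(i in [set: 'I_d])
      ((fun t => n.+1%:R * w t i 0) @^-1` `[(q i 0)%:~R, (q i 0 + 1)%:~R[%classic)).
    apply: fin_bigcap_measurable => // i _; rewrite -[X in measurable X]setTI.
    have mf : measurable_fun setT (fun t => n.+1%:R * w t i 0).
      by apply: measurable_funM => //; exact: measurable_cst.
    by apply: mf => //; exact: measurable_itv.
  apply/seteqP; split=> [t /= <- i _|t tq] /=.
    by rewrite in_itv /= !mxE floor_itv.
  apply/matrixP => i j; rewrite (ord1 j) mxE; apply/eqP.
  by rewrite floor_eq; have := tq i I; rewrite /= in_itv.
move=> t _.
suff gw : grid n (idx n t) @[n --> \oo] --> w t by exact: (cvg_comp _ _ gw (cphi t (w t))).
apply/cvgrPdist_le => e e0; near=> n.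
rewrite [leLHS]/Num.norm /= mx_normrE; apply/bigmax_leP; split; first exact: ltW.
move=> [i j] _ /=; rewrite (ord1 j) !mxE.
have n0 : 0 < n.+1%:R :> R by [].
have /andP[fl fu] := floor_itv (n.+1%:R * w t i 0).
set m := Num.floor _ in fl fu *.
have -> : w t i 0 - n.+1%:R^-1 * m%:~R = n.+1%:R^-1 * (n.+1%:R * w t i 0 - m%:~R).
  by rewrite mulrBr mulKf// gt_eqF.
rewrite ger0_norm; last by rewrite mulr_ge0// ?subr_ge0// invr_ge0 ltW.
apply: (@le_trans _ _ n.+1%:R^-1).
  rewrite ler_piMr ?invr_ge0// lerBlDl.
  by move: fu; rewrite intrD => /ltW.
by apply: ltW; near: n; exact: (near_infty_natSinv_lt (PosNum e0)).
Unshelve. all: end_near. Qed.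

(** Inversion is continuous off [0] and, by the convention [0^-1 = 0], constant on the remaining
    point. *)
Lemma measurable_funV (f : T -> R) : measurable_fun setT f ->
  measurable_fun setT (fun t => (f t)^-1).
Proof.
move=> mf; apply: (@measurableT_comp _ _ _ _ _ _ (@GRing.inv R)) => //.
rewrite -(setvU [set (0 : R)]); apply/measurable_funU => //.
  by apply: measurableC; exact: measurable_set1.
split.
  apply: open_continuous_measurable_fun => [|x].
    exact: (closed_openC (@closed_eq _ _)).
  by rewrite inE => /eqP x0; exact: inv_continuous.
apply: eq_measurable_fun (@measurable_cst _ _ _ _ _ (0 : R)) => x.
by rewrite inE => ->; rewrite invr0.
Qed.

Lemma measurable_fun_sqrt (f : T -> R) : measurable_fun setT f ->
  measurable_fun setT (fun t => Num.sqrt (f t)).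
Proof.
move=> mf; apply: (@measurableT_comp _ _ _ _ _ _ (@Num.sqrt R)) => //.
by apply: continuous_measurable_fun; exact: sqrt_continuous.
Qed.

Lemma measurable_norm2 d (v : T -> 'cV[R]_d) :
  (forall i, measurable_fun setT (fun t => v t i 0)) ->
  measurable_fun setT (fun t => norm2 (v t)).
Proof.
move=> mv; apply: measurable_fun_sqrt.
under eq_fun do rewrite dotvE.
by apply: measurable_sum => i; exact: measurable_funM.
Qed.

Lemma measurable_mulmx m n p (A : T -> 'M[R]_(m, n)) (B : T -> 'M[R]_(n, p)) i j :
  (forall i j, measurable_fun setT (fun t => A t i j)) ->
  (forall i j, measurable_fun setT (fun t => B t i j)) ->
  measurable_fun setT (fun t => (A t *m B t) i j).
Proof.
move=> mA mB; under eq_fun do rewrite mxE.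
by apply: measurable_sum => k; exact: measurable_funM.
Qed.

Lemma measurable_det n (A : T -> 'M[R]_n) :
  (forall i j, measurable_fun setT (fun t => A t i j)) ->
  measurable_fun setT (fun t => \det (A t)).
Proof.
move=> mA; rewrite /determinant; apply: measurable_sum => s.
apply: measurable_funM; first exact: measurable_cst.
exact: measurable_prod.
Qed.

(** Cramer's formula: entries of the inverse are cofactors, polynomial in the entries of [A], over
    the determinant. Invertibility everywhere selects that branch of [invmx]. *)
Lemma measurable_invmx n (A : T -> 'M[R]_n) i j :
  (forall t, A t \in unitmx) ->
  (forall i j, measurable_fun setT (fun t => A t i j)) ->
  measurable_fun setT (fun t => invmx (A t) i j).
Proof.
move=> uA mA.
under eq_fun do rewrite /invmx uA mxE.
apply: measurable_funM; first by apply: measurable_funV; exact: measurable_det.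
under eq_fun do rewrite mxE.
apply: measurable_funM; first exact: measurable_cst.
by apply: measurable_det => k l; under eq_fun do rewrite !mxE; exact: mA.
Qed.

End Measurability.

(** * Sampled gradients, sampled Hessians and Newton iterates as random variables *)

Section MeasurableSubsampled.
Context {R : realType} {d : nat} {dZ : measure_display} {Z : measurableType dZ}.
Variables (g : 'cV[R]_d -> Z -> 'cV[R]_d) (H : 'cV[R]_d -> Z -> 'M[R]_d).
Hypothesis dg : forall z w, differentiable (g^~ z) w.
Hypothesis gH : forall z (w u : 'cV[R]_d), is_derive w u (g^~ z) (H w z *m u).
Hypothesis mg : forall w i, measurable_fun setT (fun z => g w z i 0).
Context {dT : measure_display} {T : measurableType dT}.

Lemma measurable_gradient (w : T -> 'cV[R]_d) (xi : T -> Z) i :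
  (forall i, measurable_fun setT (fun t => w t i 0)) -> measurable_fun setT xi ->
  measurable_fun setT (fun t => g (w t) (xi t) i 0).
Proof.
move=> mw mxi; apply: (measurable_fun_caratheodory (phi := fun q t => g q (xi t) i 0)) => //.
  by move=> q; exact: (measurableT_comp (mg q i) mxi).
move=> t q; apply: (@continuous_comp _ _ _ (g^~ (xi t)) (fun x : 'cV[R]_d => x i 0)).
  exact: differentiable_continuous.
exact: coord_continuous.
Qed.

(** With no continuity of [H] in [w] at hand, column [j] is taken as the limit of difference
    quotients of [g] in the direction of the basis vector [e], with steps [1 / n.+1]; each quotient
    is measurable by the gradient case. *)
Lemma measurable_hessian (w : T -> 'cV[R]_d) (xi : T -> Z) i j :
  (forall i, measurable_fun setT (fun t => w t i 0)) -> measurable_fun setT xi ->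
  measurable_fun setT (fun t => H (w t) (xi t) i j).
Proof.
move=> mw mxi; pose s n : R := n.+1%:R^-1; pose e : 'cV[R]_d := delta_mx j 0.
apply: (@measurable_fun_cvg _ _ _ _ (fun n t => (s n)^-1 *
    (g (s n *: e + w t) (xi t) i 0 - g (w t) (xi t) i 0))).
  move=> n; apply: measurable_funM; first exact: measurable_cst.
  apply: measurable_funB; last exact: measurable_gradient.
  apply: (measurable_gradient (w := fun t => s n *: e + w t)) => // k.
  under eq_fun do rewrite mxE.
  by apply: measurable_funD => //; exact: measurable_cst.
move=> t _.
have /is_derive_cvgP gl := gH (xi t) (w t) e.
have s0 : s x @[x --> \oo] --> 0^'.
  move=> A [eps /= eps0 Aeps]; change (\forall n \near \oo, A (s n)).
  near=> n; apply: Aeps.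
    rewrite /ball /= sub0r normrN gtr0_norm ?invr_gt0//.
    by near: n; exact: (near_infty_natSinv_lt (PosNum eps0)).
  by rewrite /s invr_eq0 pnatr_eq0.
have gs := cvg_comp _ _ s0 gl.
have /(_ _) := continuous_cvg _ (@coord_continuous R d 1 i 0 (H (w t) (xi t) *m e)) gs.
rewrite -colE mxE; apply: cvg_trans; apply: near_eq_cvg; near=> n.
by rewrite /= !mxE.
Unshelve. all: end_near. Qed.

Lemma measurable_gradS (w : T -> 'cV[R]_d) n (xi : nat -> T -> Z) i :
  (forall i, measurable_fun setT (fun t => w t i 0)) ->
  (forall l, (l < n)%N -> measurable_fun setT (xi l)) ->
  measurable_fun setT (fun t => gradS g n (xi^~ t) (w t) i 0).
Proof.
move=> mw mxi; rewrite /gradS.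
under eq_fun do rewrite mxE summxE.
apply: measurable_funM; first exact: measurable_cst.
apply: measurable_sum => l; apply: measurable_gradient => //.
exact: mxi.
Qed.

Lemma measurable_hessS (w : T -> 'cV[R]_d) n (xi : nat -> T -> Z) i j :
  (forall i, measurable_fun setT (fun t => w t i 0)) ->
  (forall l, (l < n)%N -> measurable_fun setT (xi l)) ->
  measurable_fun setT (fun t => hessS H n (xi^~ t) (w t) i j).
Proof.
move=> mw mxi; rewrite /hessS.
under eq_fun do rewrite mxE summxE.
apply: measurable_funM; first exact: measurable_cst.
apply: measurable_sum => l; apply: measurable_hessian => //.
exact: mxi.
Qed.

(** Only draws of steps before [k] are asked to be measurable, so that [T] may carry just the
    sigma-algebra generated by them. *)
Lemma measurable_sn_iter (nX nS : nat -> nat) (xiX xiS : nat -> nat -> T -> Z) w0 k i :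
  (forall n zs w, (0 < n)%N -> hessS H n zs w \in unitmx) ->
  (forall l, (0 < nS l)%N) ->
  (forall l m, (l < k)%N -> (m < nX l)%N -> measurable_fun setT (xiX l m)) ->
  (forall l m, (l < k)%N -> (m < nS l)%N -> measurable_fun setT (xiS l m)) ->
  measurable_fun setT (fun t => sn_iter g H nX nS xiX xiS w0 k t i 0).
Proof.
move=> uH nS0; elim: k i => [|k ih] i mX mS; first exact: measurable_cst.
have {}ih j : measurable_fun setT (fun t => sn_iter g H nX nS xiX xiS w0 k t j 0).
  by apply: ih => l m lk; [apply: mX | apply: mS]; exact: ltnW.
rewrite /=; under eq_fun do rewrite mxE [X in _ + X]mxE.
apply: measurable_funB; first exact: ih.
apply: measurable_mulmx => a b.
  apply: measurable_invmx => [t|{}a {}b]; first exact: uH.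
  apply: (measurable_hessS (w := sn_iter g H nX nS xiX xiS w0 k) (xi := xiS k)) => //.
  by move=> l; exact: mS.
rewrite (ord1 b).
apply: (measurable_gradS (w := sn_iter g H nX nS xiX xiS w0 k) (xi := xiX k)) => //.
by move=> l; exact: mX.
Qed.

End MeasurableSubsampled.

(** * Independence *)

Section IndependentPair.
Local Open Scope ereal_scope.
Context {d d1 d2 : measure_display} {T : measurableType d}
  {T1 : measurableType d1} {T2 : measurableType d2} {R : realType}.
Variables (P : probability T R) (X : {mfun T >-> T1}) (Y : {mfun T >-> T2}).
Hypothesis indep : forall A B, measurable A -> measurable B ->
  P (X @^-1` A `&` Y @^-1` B) = P (X @^-1` A) * P (Y @^-1` B).

Let mXY : measurable_fun setT (fun t => (X t, Y t)).
Proof. by apply: measurable_fun_pair; exact: measurable_funPT. Qed.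

Let XY : {mfun T >-> (T1 * T2)%type} := mfun_Sub (mem_set mXY).

Let law_pair A : measurable A ->
  (distribution P X \x distribution P Y) A = distribution P XY A.
Proof. by move=> mA; apply: product_measure_unique => // B C mB mC; exact: indep. Qed.

(** By independence the law of the pair is the product of the laws, so Tonelli allows a bound for
    each frozen value of [X] to be integrated. *)
Lemma independent_freezing (phi : T1 * T2 -> \bar R) (b : T1 -> \bar R) :
  measurable_fun setT phi -> (forall x, 0 <= phi x) -> measurable_fun setT b ->
  (forall x, \int[P]_t phi (x, Y t) <= b x) ->
  \int[P]_t phi (X t, Y t) <= \int[P]_t b (X t).
Proof.
move=> mphi phi0 mb phib.
have inner x : \int[distribution P Y]_y phi (x, y) = \int[P]_t phi (x, Y t).
  by rewrite ge0_integral_distribution//; apply: measurableT_comp.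
have b0 x : 0 <= b x by apply: le_trans (phib x); exact: integral_ge0.
have -> : \int[P]_t phi (X t, Y t) = \int[distribution P XY]_z phi z.
  by rewrite ge0_integral_distribution.
rewrite (eq_measure_integral (distribution P X \x distribution P Y)%E); last first.
  by move=> A mA _; apply/esym; exact: law_pair.
rewrite fubini_tonelli1//.
have -> : \int[P]_t b (X t) = \int[distribution P X]_x b x.
  by rewrite ge0_integral_distribution.
apply: ge0_le_integral => //.
- by move=> x _; exact: integral_ge0.
- exact: measurable_fun_fubini_tonelli_F.
- by move=> x _; rewrite /fubini_F inner.
Qed.

(** Serves to kill the cross terms in the variance of a sample mean. The integrand has no sign, so
    Fubini requires the integrability of the product. *)
Lemma independent_product_mean0 (h1 : T1 -> R) (h2 : T2 -> R) :
  measurable_fun setT h1 -> measurable_fun setT h2 ->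
  P.-integrable setT (fun t => (h2 (Y t))%:E) ->
  P.-integrable setT (fun t => (h1 (X t) * h2 (Y t))%:E) ->
  \int[P]_t (h2 (Y t))%:E = 0 ->
  \int[P]_t (h1 (X t) * h2 (Y t))%:E = 0.
Proof.
move=> mh1 mh2 ih2 ih h20.
pose h (z : T1 * T2) := (h1 z.1 * h2 z.2)%:E.
have mh : measurable_fun setT h.
  apply/measurable_EFinP; apply: measurable_funM.
    by apply: (measurableT_comp mh1).
  by apply: (measurableT_comp mh2).
have -> : \int[P]_t (h1 (X t) * h2 (Y t))%:E = \int[distribution P XY]_z h z.
  by rewrite integral_distribution.
rewrite (eq_measure_integral (distribution P X \x distribution P Y)%E); last first.
  by move=> A mA _; apply/esym; exact: law_pair.
rewrite -integral12_prod_meas1; last first.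
  apply/integrableP; split => //.
  rewrite (eq_measure_integral (distribution P XY)); last by move=> A mA _; exact: law_pair.
  rewrite ge0_integral_distribution//; last exact: measurableT_comp.
  by have /integrableP[] := ih.
apply: integral0_eq => x _; rewrite /fubini_F /h /=.
under eq_integral do rewrite EFinM.
have mEh2 : measurable_fun setT (EFin \o h2) by exact/measurable_EFinP.
rewrite integralZl//.
  rewrite (_ : \int[_]_y _ = 0) ?mule0//.
  by rewrite -h20 integral_distribution.
apply/integrableP; split => //.
rewrite ge0_integral_distribution//; last exact: measurableT_comp.
by have /integrableP[] := ih2.
Qed.

End IndependentPair.

(** * Independence of the sigma-algebras generated by disjoint families of draws *)

Section IndependentSigmaAlgebras.
Local Open Scope ereal_scope.
Context {d : measure_display} {T : measurableType d} {R : realType}.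
Variable P : probability T R.

(** Both sides are finite measures in [A], namely the restriction of [P] to [F] and [P] scaled by
    [P F]; measures that agree on a pi-system containing the whole space agree on the sigma-algebra
    it generates. *)
Lemma independent_event_generated (G : set (set T)) (F : set T) :
  G `<=` measurable -> setI_closed G -> G setT -> measurable F ->
  (forall A, G A -> P (A `&` F) = P A * P F) ->
  forall A, <<s G >> A -> P (A `&` F) = P A * P F.
Proof.
move=> mG IG GT mF GF A sA.
have PF0 : (0 <= fine (P F))%R by exact: fine_ge0.
have PFE : (fine (P F))%:E = P F by rewrite fineK// fin_num_measure.
have mE B : mscale (NngNum PF0) P B = P B * P F by rewrite muleC -[in RHS]PFE.
rewrite -mE.
apply: (@g_sigma_algebra_measure_unique _ R T G mG (fun=> setT) _ _ (mrestr P mF)) => //.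
- by rewrite bigcup_const//; exists 0%N.
- by move=> B GB; rewrite [RHS]mE; exact: GF.
- move=> _; apply: (le_lt_trans _ (ltry 1%R)).
  by apply: probability_le1; exact: measurableI.
Qed.

Context {dZ : measure_display} {Z : measurableType dZ} {I : choiceType}.
Variables (xi : I -> T -> Z) (V : set I).
Hypothesis mxi : forall j, V j -> measurable_fun setT (xi j).
Hypothesis indep : mutually_independent P xi V.

(** The pi-system that generates the sigma-algebra of the family indexed by [U]. Lists may repeat
    indices, so concatenation gives intersections; [undup] pays for this when independence is
    applied. *)
Definition cylinders (U : set I) : set (set T) :=
  [set E | exists (J : seq I) (A : I -> set Z), [/\ forall j, j \in J -> U j,
     forall j, measurable (A j) &
     E = \bigcap_(j in [set j | j \in J]) (xi j @^-1` A j)]].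

Lemma cylindersT U : cylinders U setT.
Proof.
exists [::], (fun=> setT); split => //.
by apply/seteqP; split => // t _ j.
Qed.

Lemma cylinders_setI_closed U : setI_closed (cylinders U).
Proof.
move=> _ _ [J1 [A1 [JU1 mA1 ->]]] [J2 [A2 [JU2 mA2 ->]]].
pose B1 j := if j \in J1 then A1 j else setT.
pose B2 j := if j \in J2 then A2 j else setT.
exists (J1 ++ J2), (fun j => B1 j `&` B2 j); split.
- by move=> j; rewrite mem_cat => /orP[/JU1|/JU2].
- by move=> j; apply: measurableI; rewrite /B1 /B2; case: ifP.
apply/seteqP; split=> [t [h1 h2] j /= _|t h].
  by split; rewrite /B1 /B2; case: ifP => // jJ; [exact: h1 | exact: h2].
split=> j /= jJ.
  have : j \in J1 ++ J2 by rewrite mem_cat jJ.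
  by move=> /h[]; rewrite /= /B1 jJ.
have : j \in J1 ++ J2 by rewrite mem_cat jJ orbT.
by move=> /h[_]; rewrite /= /B2 jJ.
Qed.

Lemma cylinders_measurable U : U `<=` V -> cylinders U `<=` measurable.
Proof.
move=> UV _ [J [A [JU mA ->]]].
apply: fin_bigcap_measurable => [|j /= /JU /UV Vj]; first exact: finite_seq.
by rewrite -[X in measurable X]setTI; exact: mxi.
Qed.

Lemma cylinders_sigma_measurable U : U `<=` V -> <<s cylinders U >> `<=` measurable.
Proof.
move=> UV; apply: smallest_sub; last exact: cylinders_measurable.
exact: sigma_algebra_measurable.
Qed.

Lemma cylinders_preimage U j A : U j -> measurable A -> cylinders U (xi j @^-1` A).
Proof.
move=> Uj mA; exists [:: j], (fun=> A); split => //.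
  by move=> k; rewrite inE => /eqP ->.
apply/seteqP; split=> [t At k /=|t /(_ j)]; first by rewrite inE => /eqP ->.
by apply; rewrite /= inE.
Qed.

Lemma measurable_cylinders U j : U j ->
  measurable_fun setT (xi j : g_sigma_algebraType (cylinders U) -> Z).
Proof.
move=> Uj _ A mA; rewrite setTI; apply: sub_sigma_algebra.
exact: cylinders_preimage.
Qed.

Let cylinder_probability U J (A : I -> set Z) : U `<=` V ->
  (forall j, j \in J -> U j) -> (forall j, measurable (A j)) ->
  P (\bigcap_(j in [set j | j \in J]) (xi j @^-1` A j)) =
  \prod_(j <- undup J) P (xi j @^-1` A j).
Proof.
move=> UV JU mA.
have -> : [set j | j \in J] = [set j | j \in undup J].
  by apply/seteqP; split=> j /=; rewrite mem_undup.
by apply: indep => //; [exact: undup_uniq | move=> j; rewrite mem_undup => /JU/UV].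
Qed.

Lemma cylinders_independent U1 U2 A B : U1 `<=` V -> U2 `<=` V ->
  [disjoint U1 & U2] ->
  cylinders U1 A -> cylinders U2 B -> P (A `&` B) = P A * P B.
Proof.
move=> U1V U2V U12 [J1 [A1 [JU1 mA1 ->]]] [J2 [A2 [JU2 mA2 ->]]].
rewrite (cylinder_probability U1V)// (cylinder_probability U2V)//.
have J12 j : j \in J2 -> j \notin J1.
  move=> /JU2 u2; apply/negP => /JU1 u1.
  have : (U1 `&` U2) j by [].
  by move/disj_set2P: U12 => ->.
pose C j := if j \in J1 then A1 j else A2 j.
have -> : \bigcap_(j in [set j | j \in J1]) (xi j @^-1` A1 j) `&`
    \bigcap_(j in [set j | j \in J2]) (xi j @^-1` A2 j) =
    \bigcap_(j in [set j | j \in undup J1 ++ undup J2]) (xi j @^-1` C j).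
  apply/seteqP; split=> [t [h1 h2] j /=|t h].
    rewrite mem_cat !mem_undup => /orP[jJ|jJ]; rewrite /C.
      by rewrite jJ; exact: h1.
    by rewrite (negPf (J12 _ jJ)); exact: h2.
  split=> j /= jJ.
    have /h : j \in undup J1 ++ undup J2 by rewrite mem_cat mem_undup jJ.
    by rewrite /= /C jJ.
  have /h : j \in undup J1 ++ undup J2 by rewrite mem_cat !mem_undup jJ orbT.
  by rewrite /= /C (negPf (J12 _ jJ)).
rewrite indep.
- rewrite big_cat /=; congr (_ * _); apply: eq_big_seq => j; rewrite mem_undup => jJ.
    by rewrite /C jJ.
  by rewrite /C (negPf (J12 _ jJ)).
- rewrite cat_uniq !undup_uniq /= andbT; apply/hasPn => j.
  by rewrite !mem_undup; exact: J12.
- by move=> j; rewrite mem_cat !mem_undup => /orP[/JU1/U1V|/JU2/U2V].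
- by move=> j; rewrite /C; case: ifP.
Qed.

(** The pi-system extension is applied twice: first to [B] with [A] already in its sigma-algebra,
    then to [A] with [B] a cylinder. *)
Lemma generated_independent U1 U2 A B : U1 `<=` V -> U2 `<=` V ->
  [disjoint U1 & U2] ->
  <<s cylinders U1 >> A -> <<s cylinders U2 >> B -> P (A `&` B) = P A * P B.
Proof.
move=> U1V U2V U12 sA sB.
have mA := cylinders_sigma_measurable U1V sA.
rewrite setIC muleC; move: B sB; apply: independent_event_generated => //.
- exact: cylinders_measurable.
- exact: cylinders_setI_closed.
- exact: cylindersT.
move=> B cB; rewrite setIC muleC; move: A sA {mA}; apply: independent_event_generated => //.
- exact: cylinders_measurable.
- exact: cylinders_setI_closed.
- exact: cylindersT.
- exact: cylinders_measurable cB.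
by move=> A cA; exact: (cylinders_independent U1V U2V).
Qed.

(* Condition on the [U1]-coordinates: they may be treated as constants
   while the [U2]-coordinates are integrated out. *)
Lemma freezing U1 U2 (phi : T -> T -> R) (b : T -> R) :
  U1 `<=` V -> U2 `<=` V -> [disjoint U1 & U2] ->
  measurable_fun setT (fun z : g_sigma_algebraType (cylinders U1) *
    g_sigma_algebraType (cylinders U2) => phi z.1 z.2) ->
  (forall s t, (0 <= phi s t)%R) ->
  measurable_fun setT (b : g_sigma_algebraType (cylinders U1) -> R) ->
  (forall s, \int[P]_t (phi s t)%:E <= (b s)%:E) ->
  \int[P]_t (phi t t)%:E <= \int[P]_t (b t)%:E.
Proof.
move=> U1V U2V U12 mphi phi0 mb phib.
have mid U : U `<=` V -> measurable_fun setT (id : T -> g_sigma_algebraType (cylinders U)).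
  by move=> UV _ A sA; rewrite setTI; exact: (cylinders_sigma_measurable UV).
pose X : {mfun T >-> g_sigma_algebraType (cylinders U1)} := mfun_Sub (mem_set (mid _ U1V)).
pose Y : {mfun T >-> g_sigma_algebraType (cylinders U2)} := mfun_Sub (mem_set (mid _ U2V)).
apply: (@independent_freezing _ _ _ _ _ _ _ P X Y _ (fun z => (phi z.1 z.2)%:E) (EFin \o b)).
- by move=> A B sA sB; exact: (generated_independent U1V U2V U12).
- exact/measurable_EFinP.
- by move=> z; rewrite lee_fin.
- exact/measurable_EFinP.
- exact: phib.
Qed.

End IndependentSigmaAlgebras.

(** * Sample means *)

Section SecondMoments.
Local Open Scope ereal_scope.
Context {dT : measure_display} {T : measurableType dT} {R : realType}.
Variable P : probability T R.

Lemma integrable_sqr (Y : T -> R) (V : R) : measurable_fun setT Y ->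
  \int[P]_t (Y t ^+ 2)%:E <= V%:E -> P.-integrable setT (fun t => (Y t ^+ 2)%:E).
Proof.
move=> mY YV; apply/integrableP; split.
  by apply/measurable_EFinP; exact: measurable_funX.
under eq_integral do rewrite gee0_abs ?lee_fin ?sqr_ge0//.
by rewrite (le_lt_trans YV)// ltry.
Qed.

Lemma integrable_sqr_mul (Y Y' : T -> R) :
  measurable_fun setT Y -> measurable_fun setT Y' ->
  P.-integrable setT (fun t => (Y t ^+ 2)%:E) ->
  P.-integrable setT (fun t => (Y' t ^+ 2)%:E) ->
  P.-integrable setT (fun t => (Y t * Y' t)%:E).
Proof.
move=> mY mY' iY iY'.
apply: (le_integrable _ _ _ (integrableD measurableT iY iY')) => //.
  by apply/measurable_EFinP; exact: measurable_funM.
move=> t _ /=; rewrite lee_fin [leRHS]ger0_norm ?addr_ge0 ?sqr_ge0//.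
rewrite normrM -[X in (_ <= X + _)%R]real_normK ?num_real//.
rewrite -[X in (_ <= _ + X)%R]real_normK ?num_real//.
have := sqr_ge0 (`|Y t| - `|Y' t|); have := mulr_ge0 (normr_ge0 (Y t)) (normr_ge0 (Y' t)).
by rewrite sqrrB; lra.
Qed.

Lemma integrable_of_sqr (Y : T -> R) : measurable_fun setT Y ->
  P.-integrable setT (fun t => (Y t ^+ 2)%:E) -> P.-integrable setT (EFin \o Y).
Proof.
move=> mY iY.
have i1 : P.-integrable setT (fun=> ((1 : R) ^+ 2)%:E).
  by apply: finite_measure_integrable_cst.
rewrite (_ : EFin \o Y = fun t => (Y t * 1)%:E); last by apply/funext => t; rewrite /= mulr1.
by apply: integrable_sqr_mul => //; exact: measurable_cst.
Qed.

(** Of the [n ^ 2] products only the [n] diagonal ones survive; this is the source of the rate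
    [1 / sqrt n]. *)
Lemma orthogonal_sum_sqr n (Y : 'I_n -> T -> R) (V : R) :
  (forall i, measurable_fun setT (Y i)) ->
  (forall i, \int[P]_t (Y i t ^+ 2)%:E <= V%:E) ->
  (forall i j, i != j -> \int[P]_t (Y i t * Y j t)%:E = 0) ->
  \int[P]_t ((\sum_i Y i t) ^+ 2)%:E <= (n%:R * V)%:E.
Proof.
move=> mY YV Y0.
have iY i j : P.-integrable setT (fun t => (Y i t * Y j t)%:E).
  by apply: integrable_sqr_mul => //; exact: integrable_sqr (YV _).
have -> : \int[P]_t ((\sum_i Y i t) ^+ 2)%:E =
    \int[P]_t (\sum_i \sum_j (Y i t * Y j t)%:E).
  apply: eq_integral => t _; rewrite expr2 mulr_suml -sumEFin.
  by apply: eq_bigr => i _; rewrite mulr_sumr -sumEFin.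
rewrite integral_sum//; last by move=> i; exact: integrable_sum.
have -> : (n%:R * V)%:E = \sum_(i < n) V%:E.
  by rewrite sumEFin sumr_const card_ord mulr_natl.
apply: lee_sum => i _; rewrite integral_sum// (bigD1 i)//= big1 ?adde0.
  by under eq_integral do rewrite -expr2; exact: YV.
by move=> j ji; rewrite Y0// eq_sym.
Qed.

(** Jensen by hand: integrate [x <= x^2 / (2c) + c / 2], optimal at [c = s]. Taking [c = s + e]
    keeps the divisor positive when [s = 0]. *)
Lemma integral_norm2_le d (v : T -> 'cV[R]_d) (s : R) : (0 <= s)%R ->
  (forall i, measurable_fun setT (fun t => v t i 0%R)) ->
  \sum_i \int[P]_t (v t i 0%R ^+ 2)%:E <= (s ^+ 2)%:E ->
  \int[P]_t (norm2 (v t))%:E <= s%:E.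
Proof.
move=> s0 mv vs; apply/lee_addgt0Pr => e e0; rewrite -EFinD.
have c0 : (0 < s + e)%R by rewrite ltr_wpDl.
have sc : (s <= s + e)%R by rewrite lerDl ltW.
move: (s + e)%R c0 sc => c c0 sc.
have mn := measurable_norm2 mv.
have vE : \int[P]_t (norm2 (v t) ^+ 2)%:E <= (s ^+ 2)%:E.
  apply: le_trans vs; rewrite -ge0_integral_sum//.
  - rewrite le_eqVlt; apply/orP; left; apply/eqP; apply: eq_integral => t _.
    by rewrite norm2_sqr dotvvE -sumEFin.
  - by move=> i; apply/measurable_EFinP; exact: measurable_funX.
  - by move=> i t _; rewrite lee_fin sqr_ge0.
have cc : (0 < 2 * c)%R by rewrite mulr_gt0.
have k0 : (0 <= (2 * c)^-1)%R by rewrite invr_ge0 mulr_ge0// ltW.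
apply: (@le_trans _ _ (\int[P]_t (((2 * c)^-1)%:E * (norm2 (v t) ^+ 2)%:E + (c / 2)%:E))).
  apply: ge0_le_integral => //.
  - by move=> t _; rewrite lee_fin norm2_ge0.
  - exact/measurable_EFinP.
  - apply: emeasurable_funD => //; apply: emeasurable_funM => //.
    by apply/measurable_EFinP; exact: measurable_funX.
  move=> t _; rewrite -EFinM -EFinD lee_fin.
  have h := sqr_ge0 (norm2 (v t) - c); rewrite -(ler_pM2l cc).
  rewrite mulrDr mulVKf ?mulf_neq0 ?gt_eqF//.
  by move: h; rewrite sqrrB; lra.
rewrite ge0_integralD//.
- rewrite ge0_integralZl_EFin//; last 2 first.
  + by move=> t _; rewrite lee_fin sqr_ge0.
  + by apply/measurable_EFinP; exact: measurable_funX.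
  rewrite integral_cst//= [X in _ + _ * X](_ : _ = 1) ?mule1; last exact: probability_setT.
  apply: (@le_trans _ _ (((2 * c)^-1)%:E * (s ^+ 2)%:E + (c / 2)%:E)).
    by rewrite leeD2r// lee_wpmul2l ?lee_fin.
  rewrite -EFinM -EFinD lee_fin -(ler_pM2l cc).
  rewrite mulrDr mulVKf ?mulf_neq0 ?gt_eqF//.
  have : (s ^+ 2 <= c ^+ 2)%R by rewrite ler_pXn2r ?nnegrE// ltW.
  by lra.
- by move=> t _; rewrite -EFinM lee_fin mulr_ge0// sqr_ge0.
- by apply: emeasurable_funM => //; apply/measurable_EFinP; exact: measurable_funX.
- by move=> t _; rewrite lee_fin divr_ge0// ltW.
Qed.

End SecondMoments.

Section SampleMean.
Local Open Scope ereal_scope.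
Context {dT dZ : measure_display} {T : measurableType dT} {Z : measurableType dZ}
  {R : realType} {d : nat}.
Variables (P : probability T R) (Q : probability Z R) (n : nat).
Variables (xi : 'I_n -> {mfun T >-> Z}) (h : Z -> 'cV[R]_d) (s : R).
Hypothesis n0 : (0 < n)%N.
Hypothesis law : forall i A, measurable A -> P (xi i @^-1` A) = Q A.
Hypothesis indep : forall i j A B, i != j -> measurable A -> measurable B ->
  P (xi i @^-1` A `&` xi j @^-1` B) = P (xi i @^-1` A) * P (xi j @^-1` B).
Hypothesis mh : forall k, measurable_fun setT (fun z => h z k 0%R).
Hypothesis h0 : forall k, \int[Q]_z (h z k 0%R)%:E = 0.
Hypothesis s0 : (0 <= s)%R.
Hypothesis hs : \sum_k \int[Q]_z (h z k 0%R ^+ 2)%:E <= (s ^+ 2)%:E.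

Let law_integral i (f : Z -> \bar R) :
  \int[distribution P (xi i)]_z f z = \int[Q]_z f z.
Proof. by apply: eq_measure_integral => A mA _; exact: law. Qed.

Lemma sample_mean_le :
  \int[P]_t (norm2 (n%:R^-1 *: \sum_i h (xi i t)))%:E <= (s / Num.sqrt n%:R)%:E.
Proof.
have mhx i k : measurable_fun setT (fun t => h (xi i t) k 0%R).
  by apply: (measurableT_comp (mh k)).
have nR : (0 < n%:R :> R)%R by rewrite ltr0n.
apply: integral_norm2_le; first by rewrite divr_ge0// sqrtr_ge0.
  move=> k; under eq_fun do rewrite mxE summxE.
  by apply: measurable_funM; [exact: measurable_cst | exact: measurable_sum].
have sq0 k : 0 <= \int[Q]_z (h z k 0%R ^+ 2)%:E.
  by apply: integral_ge0 => z _; rewrite lee_fin sqr_ge0.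
(* Each coordinate has a finite second moment, because the moments are nonnegative and their sum is
   bounded by [hs]. *)
pose V k := fine (\int[Q]_z (h z k 0%R ^+ 2)%:E).
have VE k : (V k)%:E = \int[Q]_z (h z k 0%R ^+ 2)%:E.
  rewrite fineK// ge0_fin_numE// (le_lt_trans _ (ltry (s ^+ 2))%R)//.
  by apply: le_trans hs; rewrite (bigD1 k)//= leeDl// sume_ge0.
have hV i k : \int[P]_t (h (xi i t) k 0%R ^+ 2)%:E = (V k)%:E.
  rewrite VE -(law_integral i) ge0_integral_distribution//.
    by apply/measurable_EFinP; exact: measurable_funX.
  by move=> z; rewrite lee_fin sqr_ge0.
have isq i k : P.-integrable setT (fun t => (h (xi i t) k 0%R ^+ 2)%:E).
  by apply: (integrable_sqr (V := V k)) => //; rewrite hV.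
have ih i k : P.-integrable setT (fun t => (h (xi i t) k 0%R)%:E).
  exact: integrable_of_sqr.
have hx0 i k : \int[P]_t (h (xi i t) k 0%R)%:E = 0.
  rewrite -(h0 k) -(law_integral i) integral_distribution//.
    exact/measurable_EFinP.
  exact: ih.
apply: (@le_trans _ _ (\sum_k (n%:R^-1 * V k)%:E)); last first.
  rewrite sumEFin -mulr_sumr.
  have : ((\sum_k V k)%:E <= (s ^+ 2)%:E) by rewrite -sumEFin; under eq_bigr do rewrite VE.
  rewrite !lee_fin => Vs; rewrite expr_div_n sqr_sqrtr ?ler0n// mulrC.
  by rewrite ler_pM2r// invr_gt0.
apply: lee_sum => k _.
under eq_integral do rewrite mxE summxE exprMn EFinM.
rewrite ge0_integralZl_EFin ?exprn_ge0 ?invr_ge0 ?ler0n//; last 2 first.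
- by move=> t _; rewrite lee_fin sqr_ge0.
- by apply/measurable_EFinP; apply: measurable_funX; exact: measurable_sum.
apply: (@le_trans _ _ (((n%:R^-1) ^+ 2)%:E * (n%:R * V k)%:E)).
  rewrite lee_wpmul2l ?lee_fin ?sqr_ge0//.
  apply: (@orthogonal_sum_sqr _ _ _ P n (fun i t => h (xi i t) k 0%R)) => //.
    by move=> i; rewrite hV.
  move=> i j ij.
  apply: (@independent_product_mean0 _ _ _ _ _ _ _ P (xi i) (xi j) _
    (fun z => h z k 0%R) (fun z => h z k 0%R)) => //.
    by move=> A B mA mB; exact: indep.
  by apply: (integrable_sqr_mul (Y := fun t => h (xi i t) k 0%R)
    (Y' := fun t => h (xi j t) k 0%R)).
by rewrite -EFinM lee_fin expr2 -!mulrA mulKf// gt_eqF.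
Qed.

End SampleMean.

(** * The scalar recursion *)

Section SuperlinearRecursion.
Context {R : realType}.
Variables (a s e : nat -> R) (A c : R).

(* The scaled majorant: the term [e k.+1 ^+ k.+1] keeps it from decaying faster
   than the sampling error, so that the latter stays negligible against it. *)
Fixpoint majorant k : R :=
  if k is l.+1 then
    Num.max (majorant l * (majorant l / 6 + s l + e l ^+ l / 2)) (e l.+1 ^+ l.+1)
  else 1.

Hypothesis a0 : forall k, 0 <= a k.
Hypothesis A0 : 0 <= A.
Hypothesis c0 : 0 <= c.
Hypothesis rec : forall k, a k.+1 <= A * a k ^+ 2 + s k * a k + c * (e k ^+ k) ^+ 2.
Hypothesis Aa0 : A * a 0%N <= 1 / 6.
Hypothesis Ac : A * c <= 1 / 12.
Hypothesis s0 : forall k, 0 <= s k <= 1 / 4.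
Hypothesis s_cvg : s @ \oo --> 0.
Hypothesis e0 : forall k, 0 < e k.+1.
Hypothesis e1 : e 1%N < 1.
Hypothesis e_decr : forall k, e k.+2 <= e k.+1.
Hypothesis e_cvg : e @ \oo --> 0.

Let e_le k : e k.+1 <= e 1%N.
Proof. by elim: k => // k; exact: le_trans. Qed.

Let r_gt0 k : 0 < e k ^+ k.
Proof. by case: k => [|k]; rewrite ?expr0// exprn_gt0. Qed.

Let r_le1 k : e k ^+ k <= 1.
Proof.
by case: k => [|k]; rewrite ?expr0// exprn_ile1 ?ltW// (le_lt_trans (e_le k)).
Qed.

(** For [k = 0] the right-hand power is [1] whatever [e 0] is; monotonicity of [e] starts at index
    [1]. *)
Let r_step k : e k.+1 ^+ k.+1 <= e k.+1 * e k ^+ k.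
Proof.
rewrite exprS ler_pM2l//; case: k => [|k]; first by rewrite !expr0.
by apply: lerXn2r; rewrite ?nnegrE//; exact: ltW.
Qed.

Let majorant_ge k : e k ^+ k <= majorant k.
Proof. by case: k => [|k] /=; rewrite ?expr0// le_max lexx orbT. Qed.

Let majorant_gt0 k : 0 < majorant k.
Proof. exact: lt_le_trans (majorant_ge k). Qed.

(** One entry for each branch of the maximum in [majorant]: as long as the majorant is at most [1],
    the bracket is at most [1/6 + 1/4 + 1/2]. *)
Let rate := Num.max (11 / 12) (e 1%N).

Let rate_lt1 : rate < 1.
Proof. by rewrite gt_max e1 andbT; lra. Qed.

Let majorant_le1_step k : majorant k <= 1 -> majorant k.+1 <= rate * majorant k.
Proof.
move=> t1 /=; rewrite ge_max; apply/andP; split.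
  rewrite mulrC ler_pM2r//; apply: le_trans (_ : 11 / 12 <= _).
    by have := r_le1 k; have /andP[_] := s0 k; lra.
  by rewrite le_max lexx.
apply: le_trans (r_step k) _; apply: ler_pM; [exact: ltW|exact: ltW| |exact: majorant_ge].
by rewrite le_max e_le orbT.
Qed.

Let majorant_le k : majorant k <= rate ^+ k.
Proof.
have rate0 : 0 <= rate by rewrite le_max; apply/orP; left; lra.
elim: k => [|k ih]; first by rewrite expr0.
have t1 : majorant k <= 1 by apply: le_trans ih _; rewrite exprn_ile1// ltW.
by apply: le_trans (majorant_le1_step t1) _; rewrite exprS ler_wpM2l.
Qed.

(** In the first branch [e k ^+ k <= majorant k] absorbs the halved term, as [1/6 + 1/2 <= 1]; the
    second branch is [r_step]. Geometric decay of the majorant then sends the right-hand side to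
    [0]. *)
Let ratio_le k : majorant k.+1 / majorant k <= majorant k + s k + e k.+1.
Proof.
have t0 := majorant_gt0 k; have := majorant_ge k; have /andP[sk _] := s0 k.
have ek := e0 k; have rk := r_gt0 k; have rs := r_step k.
rewrite ler_pdivrMr// => rt; rewrite [majorant k.+1]/= ge_max; apply/andP; split.
  by rewrite mulrC ler_pM2r//; lra.
apply: le_trans rs _; apply: ler_pM => //; [exact: ltW|exact: ltW|].
by rewrite ler_wpDl// addr_ge0// ltW.
Qed.

Let ratio_cvg : (fun k => majorant k.+1 / majorant k) @ \oo --> 0.
Proof.
apply: (@squeeze_cvgr _ _ _ _ (fun=> 0) (fun k => rate ^+ k + s k + e k.+1)).
- near=> k; apply/andP; split; first by apply: divr_ge0; exact: ltW.
  by apply: le_trans (ratio_le k) _; rewrite !lerD2r majorant_le.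
- exact: cvg_cst.
have -> : 0 = 0 + 0 + 0 :> R by rewrite !addr0.
apply: cvgD; first apply: cvgD => //.
  apply: cvg_expr; rewrite ger0_norm//.
  by rewrite le_max; apply/orP; left; lra.
by rewrite (cvg_shiftS e).
Unshelve. all: end_near. Qed.

Lemma superlinear_recursion : exists tau : nat -> R,
  [/\ forall k, 0 < tau k, forall k, a k <= tau k &
      (fun k => tau k.+1 / tau k) @ \oo --> (0 : R)].
Proof.
(* For [A > 0] the largest admissible scale [1 / (6A)] works: the lower bounds on [B] become [Aa0]
   and [Ac]. For [A = 0] the last condition is void and any large [B] will do. *)
have [B [B0 aB cB AB]] : exists B : R, [/\ 0 < B, a 0%N <= B, 2 * c <= B & A * B <= 1 / 6].
  move: A0; rewrite le_eqVlt => /predU1P[<-|Apos].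
    have a00 := a0 0%N; have c00 := c0.
    by exists (a 0%N + 2 * c + 1); split; rewrite ?mul0r; lra.
  exists (1 / 6 / A); split.
  - by rewrite divr_gt0//; lra.
  - by rewrite ler_pdivlMr// mulrC.
  - by rewrite ler_pdivlMr//; have := Ac; lra.
  - by rewrite mulrC divfK// gt_eqF.
exists (fun k => B * majorant k); split.
- by move=> k; rewrite mulr_gt0.
- elim=> [|k ih]; first by rewrite mulr1.
  set t := majorant k in ih *; set r := e k ^+ k.
  have rt : r <= t by exact: majorant_ge.
  have t0 : 0 < t by exact: majorant_gt0.
  have r0 : 0 < r by exact: r_gt0.
  have /andP[sk _] := s0 k.
  apply: (@le_trans _ _ (B * (t * (t / 6 + s k + r / 2)))); last first.
    by rewrite ler_pM2l//= le_max lexx.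
  apply: le_trans (rec k) _.
  (* Term by term comparison with [rec]: [A * B <= 1/6] handles the square, and [c <= B / 2] with
     [r <= t] bounds the noise [c * r ^+ 2]. *)
  have -> : B * (t * (t / 6 + s k + r / 2)) =
    1 / 6 * B * t ^+ 2 + s k * (B * t) + B / 2 * (t * r) by lra.
  apply: lerD; first apply: lerD.
  - apply: (@le_trans _ _ (A * (B * t) ^+ 2)).
      by rewrite ler_wpM2l// ler_pXn2r ?nnegrE// ltW// mulr_gt0.
    have -> : A * (B * t) ^+ 2 = A * B * (B * t ^+ 2) by ring.
    by rewrite -[leRHS]mulrA; apply: ler_wpM2r => //; rewrite mulr_ge0 ?exprn_ge0// ltW.
  - by rewrite ler_wpM2l.
  - rewrite expr2; apply: ler_pM => //; first by rewrite mulr_ge0// ltW.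
      by lra.
    by rewrite ler_pM2r.
- rewrite (_ : (fun k => _) = fun k => majorant k.+1 / majorant k)//.
  by apply/funext => k; rewrite -mulf_div divff ?mul1r// gt_eqF.
Qed.

End SuperlinearRecursion.

(** * Sampled gradients and Hessians *)

Section Expectations.
Context {dZ : measure_display} {Z : measurableType dZ} {R : realType} {d : nat}.
Variable Q : probability Z R.

Lemma integrable_bounded (f : Z -> R) (C : R) : measurable_fun setT f ->
  (forall z, `|f z| <= C) -> Q.-integrable setT (EFin \o f).
Proof.
move=> mf fC.
apply: (@le_integrable _ _ _ _ _ _ _ (fun=> C%:E)) => //.
- exact/measurable_EFinP.
- by move=> z _ /=; rewrite lee_fin (le_trans (fC z))// ler_norm.
- exact: finite_measure_integrable_cst.
Qed.

Lemma mexpE (A : Z -> 'M[R]_d) i j : Q.-integrable setT (fun z => (A z i j)%:E) ->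
  (\int[Q]_z (A z i j)%:E = (mexp Q A i j)%:E)%E.
Proof. by move=> iA; rewrite mxE /Rintegral fineK// integrable_fin_num. Qed.

Lemma integral_lincomb (I : Type) (r : seq I) (f : I -> Z -> R) (m c : I -> R) :
  (forall i, Q.-integrable setT (EFin \o f i)) ->
  (forall i, (\int[Q]_z (f i z)%:E = (m i)%:E)%E) ->
  (\int[Q]_z (\sum_(i <- r) c i * f i z)%:E = (\sum_(i <- r) c i * m i)%:E)%E.
Proof.
move=> fi fm; under eq_integral do rewrite -sumEFin.
rewrite integral_sum//; last first.
  by move=> i; exact: (integrableZl measurableT (c i) (fi i)).
rewrite -sumEFin; apply: eq_bigr => i _.
by under eq_integral do rewrite EFinM; rewrite (integralZl measurableT (fi i)) [X in (_ * X)%E]fm.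
Qed.

Lemma integral_quadratic_form (A : Z -> 'M[R]_d) (u : 'cV[R]_d) :
  (forall i j, Q.-integrable setT (fun z => (A z i j)%:E)) ->
  (\int[Q]_z (dotv u (A z *m u))%:E = (dotv u (mexp Q A *m u))%:E)%E.
Proof.
move=> iA.
have E B : dotv u (B *m u) = \sum_(p : 'I_d * 'I_d) u p.1 0 * u p.2 0 * B p.1 p.2.
  rewrite dotvE -(pair_bigA _ (fun i j => u i 0 * u j 0 * B i j)) /=.
  apply: eq_bigr => i _; rewrite mxE mulr_sumr; apply: eq_bigr => j _.
  by rewrite mulrA mulrAC.
under eq_integral do rewrite E; rewrite E.
by apply: integral_lincomb => p; [exact: iA | exact: mexpE].
Qed.

End Expectations.

(** Diagonal entries are at most [L], and testing positivity on [e i + e j] and [e i - e j] bounds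
    the others by polarization. Bounded entries make sampled Hessians and their products integrable,
    so that [mexp], built on a real-valued integral with a default, is a genuine expectation. *)
Lemma sym_loewner_entry_le {R : realType} {d : nat} (A : 'M[R]_d) (L : R) i j :
  A^T = A -> loewner_le (0 *: 1%:M) A -> loewner_le A (L *: 1%:M) -> `|A i j| <= L.
Proof.
move=> symA A0 AL.
pose e k : 'cV[R]_d := delta_mx k 0.
have eAe k l : dotv (e k) (A *m e l) = A k l.
  rewrite -colE dotvE (bigD1 k)//= big1 ?addr0; last first.
    by move=> m mk; rewrite !mxE (negPf mk) mul0r.
  by rewrite !mxE !eqxx mul1r.
have diag k : A k k <= L.
  have := loewner_scalar_ge (e k) AL; rewrite eAe norm2_sqr dotvvE (bigD1 k)//= big1.
    by rewrite !mxE !eqxx expr1n addr0 mulr1.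
  by move=> m mk; rewrite !mxE (negPf mk) expr0n.
have Aji : A j i = A i j by rewrite -[in LHS]symA mxE.
have := loewner_scalar_le (e i + e j) A0; have := loewner_scalar_le (e i - e j) A0.
rewrite !mul0r !mulmxDr mulmxN !dotvDl !dotvDr !dotvNl !dotvNr !eAe Aji.
by have := diag i; have := diag j; rewrite ler_norml; lra.
Qed.

Section SampledDerivatives.
Local Open Scope ereal_scope.
Context {R : realType} {d : nat} {dO dZ : measure_display}
  {T : measurableType dO} {Z : measurableType dZ}.
Variables (P : probability T R) (Q : probability Z R) (n : nat).
Variables (xi : nat -> T -> Z).
Hypothesis n0 : (0 < n)%N.
Hypothesis mxi : forall i, (i < n)%N -> measurable_fun setT (xi i).
Hypothesis law : forall i A, (i < n)%N -> measurable A -> P (xi i @^-1` A) = Q A.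
Hypothesis indep : forall i j A B, (i < n)%N -> (j < n)%N -> i != j ->
  measurable A -> measurable B ->
  P (xi i @^-1` A `&` xi j @^-1` B) = P (xi i @^-1` A) * P (xi j @^-1` B).

Lemma sample_mean_nat_le (h : Z -> 'cV[R]_d) (s : R) :
  (forall k, measurable_fun setT (fun z => h z k 0%R)) ->
  (forall k, \int[Q]_z (h z k 0%R)%:E = 0) -> (0 <= s)%R ->
  \sum_k \int[Q]_z (h z k 0%R ^+ 2)%:E <= (s ^+ 2)%:E ->
  \int[P]_t (norm2 (n%:R^-1 *: \sum_(i < n) h (xi i t)))%:E <= (s / Num.sqrt n%:R)%:E.
Proof.
move=> mh h0 s0 hs.
pose X (i : 'I_n) : {mfun T >-> Z} := mfun_Sub (mem_set (mxi (ltn_ord i))).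
apply: (@sample_mean_le _ _ _ _ _ _ P Q n X h s) => //.
- by move=> i A mA; exact: law.
- by move=> i j A B ij mA mB; exact: indep.
Qed.

Lemma sampled_gradient_error (G : Z -> 'cV[R]_d) (m : 'cV[R]_d) (v : R) :
  (forall k, measurable_fun setT (fun z => G z k 0%R)) ->
  (forall k, \int[Q]_z (G z k 0%R)%:E = (m k 0%R)%:E) -> (0 <= v)%R ->
  trCov Q G <= (v ^+ 2)%:E ->
  \int[P]_t (norm2 (n%:R^-1 *: (\sum_(i < n) G (xi i t)) - m))%:E
    <= (v / Num.sqrt n%:R)%:E.
Proof.
move=> mG Gm v0 Gv.
have E t : (n%:R^-1 *: (\sum_(i < n) G (xi i t)) - m =
            n%:R^-1 *: \sum_(i < n) (G (xi i t) - m))%R.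
  rewrite sumrB sumr_const card_ord scalerBr -[(m *+ n)%R]scaler_nat scalerA mulVf ?scale1r//.
  by rewrite pnatr_eq0 -lt0n.
under eq_integral do rewrite E.
have sq : \sum_k \int[Q]_z ((G z - m)%R k 0%R ^+ 2)%:E <= (v ^+ 2)%:E.
  apply: le_trans Gv; rewrite le_eqVlt; apply/orP; left; apply/eqP.
  apply: eq_bigr => k _; apply: eq_integral => z _.
  by rewrite !mxE /Rintegral Gm.
have mh k : measurable_fun setT (fun z => (G z - m)%R k 0%R).
  by under eq_fun do rewrite !mxE; apply: measurable_funB => //; exact: measurable_cst.
apply: (sample_mean_nat_le (h := fun z => G z - m)%R) => // k.
(* Integrability of the centred coordinate comes from its second moment; its mean is then found by
   adding the constant [m k 0] back and cancelling. *)
have ih : Q.-integrable setT (fun z => ((G z - m)%R k 0%R)%:E).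
  apply: integrable_of_sqr => //; apply: (integrable_sqr (V := v ^+ 2)) => //.
  apply: le_trans sq; rewrite [leRHS](bigD1 k)//= leeDl// sume_ge0// => i _.
  by apply: integral_ge0 => z _; rewrite lee_fin sqr_ge0.
have ic : Q.-integrable setT (fun=> (m k 0%R)%:E) by exact: finite_measure_integrable_cst.
have : \int[Q]_z (((G z - m)%R k 0%R)%:E + (m k 0%R)%:E) = 0 + (m k 0%R)%:E.
  by rewrite add0e -[RHS]Gm; apply: eq_integral => z _; rewrite !mxE -EFinD subrK.
rewrite integralD// integral_cst//=.
rewrite [X in _ + _ * X](_ : _ = 1) ?mule1; last exact: probability_setT.
by move/(congr1 (fun x => x - (m k 0%R)%:E)); rewrite !addeK.
Qed.

Lemma sampled_hessian_error (A : Z -> 'M[R]_d) (B : 'M[R]_d) (L sigma : R) (u : 'cV[R]_d) :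
  (forall i j, measurable_fun setT (fun z => A z i j)) ->
  (forall z, (A z)^T = A z)%R ->
  (forall z, loewner_le (0 *: 1%:M) (A z))%R ->
  (forall z, loewner_le (A z) (L *: 1%:M))%R ->
  (forall i j, \int[Q]_z (A z i j)%:E = (B i j)%:E) -> (0 <= sigma)%R ->
  (opnorm (mexp Q (fun z => (A z - B) *m (A z - B))) <= sigma ^+ 2)%R ->
  \int[P]_t (norm2 ((n%:R^-1 *: (\sum_(i < n) A (xi i t)) - B) *m u))%:E
    <= (sigma / Num.sqrt n%:R * norm2 u)%:E.
Proof.
move=> mA symA A0 AL AB s0 As.
have E t : ((n%:R^-1 *: (\sum_(i < n) A (xi i t)) - B) *m u =
            n%:R^-1 *: \sum_(i < n) (A (xi i t) - B) *m u)%R.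
  rewrite -mulmx_suml sumrB sumr_const card_ord scalemxAl scalerBr -[(B *+ n)%R]scaler_nat.
  by rewrite scalerA mulVf ?scale1r// pnatr_eq0 -lt0n.
under eq_integral do rewrite E.
have Abd z i j : (`|A z i j| <= L)%R by exact: sym_loewner_entry_le.
have iA i j : Q.-integrable setT (EFin \o (fun z => A z i j)) by exact: integrable_bounded.
have symB : (B^T = B)%R.
  apply/matrixP => i j; rewrite mxE; apply: EFin_inj; rewrite -!AB.
  by apply: eq_integral => z _; rewrite -[in LHS]symA mxE.
have mD i j : measurable_fun setT (fun z => (A z - B)%R i j).
  by under eq_fun do rewrite !mxE; apply: measurable_funB => //; exact: measurable_cst.
have Dbd z i j : (`|(A z - B)%R i j| <= L + `|B i j|)%R.
  by rewrite !mxE (le_trans (ler_normB _ _))// lerD2r.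
have iD i j : Q.-integrable setT (fun z => ((A z - B)%R i j)%:E).
  exact: integrable_bounded.
have D0 i j : \int[Q]_z ((A z - B)%R i j)%:E = 0%:E.
  under eq_integral do rewrite !mxE EFinB.
  rewrite (integralB measurableT (iA i j)); last exact: finite_measure_integrable_cst.
  rewrite integral_cst//= [X in _ - _ * X](_ : _ = 1); last exact: probability_setT.
  by rewrite mule1 [X in X - _]AB subee.
(* Regroups the bound as [(sigma * norm2 u) / sqrt n], so that [sigma * norm2 u] is the deviation in
   the sample-mean estimate. *)
rewrite mulrAC.
apply: (sample_mean_nat_le (h := fun z => ((A z - B) *m u)%R)).
- by move=> k; apply: measurable_mulmx => // i j; exact: measurable_cst.
- move=> k; under eq_integral => z _ do rewrite mxE (eq_bigr _ (fun j _ => mulrC _ _)).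
  rewrite (@integral_lincomb _ _ _ _ _ _ (fun j z => (A z - B)%R k j)
    (fun=> 0%R) (fun j => u j 0%R))//; last first.
    by move=> j; exact: iD.
  by rewrite big1// => j _; rewrite mulr0.
- by rewrite mulr_ge0// norm2_ge0.
rewrite -ge0_integral_sum//; last 2 first.
- move=> k; apply/measurable_EFinP; apply: measurable_funX.
  by apply: measurable_mulmx => // i j; exact: measurable_cst.
- by move=> k z _; rewrite lee_fin sqr_ge0.
have -> : \int[Q]_z (\sum_k (((A z - B) *m u)%R k 0%R ^+ 2)%:E)%R =
          \int[Q]_z (dotv u ((A z - B) *m (A z - B) *m u))%:E.
  apply: eq_integral => z _; rewrite sumEFin -dotvvE dotv_mull.
  by rewrite linearB /= symA symB mulmxA.
rewrite integral_quadratic_form; last first.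
  move=> i j; apply: (@integrable_bounded _ _ _ Q _ (\sum_k (L + `|B i k|) * (L + `|B k j|))%R).
    exact: measurable_mulmx.
  move=> z; rewrite mxE (le_trans (ler_norm_sum _ _ _))//; apply: ler_sum => k _.
  by rewrite normrM ler_pM.
rewrite lee_fin exprMn (le_trans (dotv_mul_le _ _ _))// -mulrA -expr2.
by rewrite ler_wpM2r// exprn_ge0// norm2_ge0.
Qed.

End SampledDerivatives.

(** * One step of the iteration *)

Lemma loewner_scalar_trans {R : realType} {d : nat} (a b : R) (A : 'M[R]_d) :
  a <= b -> loewner_le (b *: 1%:M) A -> loewner_le (a *: 1%:M) A.
Proof.
move=> ab bA v; have := loewner_scalar_le v bA.
rewrite mulmxBl -scalemxAl mul1mx dotvBr dotvZr subr_ge0 norm2_sqr.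
by apply: le_trans; rewrite ler_wpM2r// dotvv_ge0.
Qed.

Lemma newton_step_error {R : realType} {d : nat} (a : R) (A B : 'M[R]_d)
    (w ws gs G : 'cV[R]_d) : 0 < a -> loewner_le (a *: 1%:M) A ->
  norm2 (w - invmx A *m gs - ws) <= a^-1 *
    (norm2 ((A - B) *m (w - ws)) + norm2 (B *m (w - ws) - G) + norm2 (gs - G)).
Proof.
move=> a0 aA.
have -> : w - invmx A *m gs - ws = invmx A *m (A *m (w - ws) - gs).
  by rewrite mulmxBr mulmxA mulVmx ?(loewner_unitmx a0)// mul1mx addrAC.
apply: le_trans (loewner_invmx_le _ a0 aA) _.
rewrite ler_pM2l ?invr_gt0//.
have -> : A *m (w - ws) - gs = (A - B) *m (w - ws) + (B *m (w - ws) - G) + (G - gs).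
  by rewrite mulmxBl !addrA !subrK.
by apply: le_trans (norm2D _ _) _; rewrite [norm2 (G - gs)]norm2B lerD2r norm2D.
Qed.

Lemma sqrt_cvgy {R : realType} (x : nat -> R) :
  x @ \oo --> +oo -> (fun k => Num.sqrt (x k)) @ \oo --> +oo.
Proof.
move=> /cvgryPge xy; apply/cvgryPge => b; near=> k.
apply: le_trans (ler_norm b) _; rewrite -sqrtr_sqr; apply: ler_wsqrtr.
by near: k; exact: xy.
Unshelve. all: end_near. Qed.

Lemma inv_cvgy0 {R : realType} (x : nat -> R) :
  x @ \oo --> +oo -> (fun k => (x k)^-1) @ \oo --> 0.
Proof.
move=> xy; apply/(@gtr0_cvgV0 _ _ _ _ x) => //.
have /cvgryPge/(_ 1) := xy; apply: filterS => k; exact: lt_le_trans.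
Qed.

Lemma sqrtrX {R : realType} (x : R) k : 0 <= x -> Num.sqrt (x ^+ k) = Num.sqrt x ^+ k.
Proof.
move=> x0; elim: k => [|k ih]; first by rewrite !expr0 sqrtr1.
by rewrite !exprS sqrtrM// ih.
Qed.

Section ExpectedStep.
Context {R : realType} {d : nat} {dO dZ : measure_display}
  {Omega : measurableType dO} {Z : measurableType dZ}.
Variables (Pr : probability Omega R) (PZ : probability Z R).
Variables (g : 'cV[R]_d -> Z -> 'cV[R]_d) (H : 'cV[R]_d -> Z -> 'M[R]_d).
Variables (gF : 'cV[R]_d -> 'cV[R]_d) (HF : 'cV[R]_d -> 'M[R]_d).
Variables (wstar w0 : 'cV[R]_d) (nX nS : nat -> nat).
Variables (xiX xiS : nat -> nat -> Omega -> Z) (mubar L v M sigma : R).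

(** An index [(b, k, i)] names draw [i] of step [k], in the gradient sample if [b] is true and in
    the Hessian sample otherwise. A single family lets past and current draws be subsets of one
    index set. *)
Let valid := [set j : bool * nat * nat | (j.2 < (if j.1.1 then nX else nS) j.1.2)%N].
Let xi (j : bool * nat * nat) := (if j.1.1 then xiX else xiS) j.1.2 j.2.

Hypothesis Hg_diff : forall z w, differentiable (g^~ z) w /\
  forall u : 'cV[R]_d, is_derive w u (g^~ z) (H w z *m u).
Hypothesis H_sym : forall w z, (H w z)^T = H w z.
Hypothesis Hg_meas : forall w i, measurable_fun setT (fun z => g w z i 0).
Hypothesis HH_meas : forall w i j, measurable_fun setT (fun z => H w z i j).
Hypothesis Hg_unb : forall w i, (\int[PZ]_z (g w z i 0)%:E = (gF w i 0)%:E)%E.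
Hypothesis HH_unb : forall w i j, (\int[PZ]_z (H w z i j)%:E = (HF w i j)%:E)%E.
Hypothesis HnX_pos : forall k, (0 < nX k)%N.
Hypothesis HnS_pos : forall k, (0 < nS k)%N.
Hypothesis Hxi_meas : forall j, valid j -> measurable_fun setT (xi j).
Hypothesis Hxi_dist : forall j, valid j ->
  forall A, measurable A -> Pr (xi j @^-1` A) = PZ A.
Hypothesis Hxi_indep : mutually_independent Pr xi valid.
Hypothesis HgF_diff : forall w, differentiable gF w /\
  forall u : 'cV[R]_d, is_derive w u gF (HF w *m u).
Hypothesis HHF_cont : continuous HF.
Hypothesis gF_star : gF wstar = 0.
Hypothesis Hmubar : 0 < mubar.
Hypothesis HA1S : forall n zs w, (0 < n)%N -> loewner_le (mubar *: 1%:M) (hessS H n zs w).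
Hypothesis HA1L : forall w z, loewner_le (H w z) (L *: 1%:M).
Hypothesis Hv : 0 <= v.
Hypothesis HA2 : forall w, (trCov PZ (g w) <= (v ^+ 2)%:E)%E.
Hypothesis HM : 0 <= M.
Hypothesis HA3 : forall w z, opnorm (HF w - HF z) <= M * norm2 (w - z).
Hypothesis Hsigma : 0 <= sigma.
Hypothesis HA4 : forall w,
  opnorm (mexp PZ (fun z => (H w z - HF w) *m (H w z - HF w))) <= sigma ^+ 2.

Let W := sn_iter g H nX nS xiX xiS w0.
Let err k om := norm2 (W k om - wstar).
Let dg z w : differentiable (g^~ z) w. Proof. by case: (Hg_diff z w). Qed.
Let gH z (w u : 'cV[R]_d) : is_derive w u (g^~ z) (H w z *m u).
Proof. by case: (Hg_diff z w). Qed.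

Let past k := [set j | valid j /\ (j.1.2 < k)%N].
Let block b k := [set j | [/\ valid j, j.1.1 = b & j.1.2 = k]].

Let past_valid k : past k `<=` valid. Proof. by move=> j []. Qed.
Let block_valid b k : block b k `<=` valid. Proof. by move=> j []. Qed.
Let past_block b k : [disjoint past k & block b k].
Proof.
apply/disj_set2P/seteqP; split => // j [[_ jk] [_ _ jE]].
by move: jk; rewrite jE ltnn.
Qed.

Let hess_unit n zs w : (0 < n)%N -> hessS H n zs w \in unitmx.
Proof. by move=> n0; apply: (loewner_unitmx Hmubar); exact: HA1S. Qed.

(** A1 at sample size one concerns a single Hessian. *)
Let H_ge0 w z : loewner_le (0 *: 1%:M) (H w z).
Proof.
apply: (loewner_scalar_trans (ltW Hmubar)).
have := @HA1S 1%N (fun=> z) w (ltn0Sn _).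
by rewrite /hessS big_ord1 invr1 scale1r.
Qed.

(** The map [X] allows a change of sigma-algebra: it is the identity in both uses, from [Omega]
    itself and from [Omega] with the sigma-algebra of the past. *)
Lemma measurable_iterate dT (T : measurableType dT) (X : T -> Omega) k i :
  (forall j, past k j -> measurable_fun setT (xi j \o X)) ->
  measurable_fun setT (fun t => W k (X t) i 0).
Proof.
move=> mxi.
pose yX l m := xiX l m \o X; pose yS l m := xiS l m \o X.
have WE l t : W l (X t) = sn_iter g H nX nS yX yS w0 l t.
  by elim: l => //= l; rewrite /W /= => ->.
under eq_fun do rewrite WE.
apply: measurable_sn_iter => // l m lk mn.
- by apply: (mxi (true, l, m)).
- by apply: (mxi (false, l, m)).
Qed.

Let measurable_err k : measurable_fun setT (err k).
Proof.
apply: measurable_norm2 => i; under eq_fun do rewrite !mxE.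
apply: measurable_funB; last exact: measurable_cst.
by apply: (@measurable_iterate _ _ id) => j /past_valid; exact: Hxi_meas.
Qed.

Let measurable_past_iterate k i : measurable_fun setT
  (fun t : g_sigma_algebraType (cylinders xi (past k)) => W k t i 0).
Proof.
apply: (@measurable_iterate _ (g_sigma_algebraType (cylinders xi (past k))) id) => j.
exact: measurable_cylinders.
Qed.

Let law_indep b k :
  (forall i, (i < (if b then nX else nS) k)%N -> measurable_fun setT (xi (b, k, i))) /\
  (forall i A, (i < (if b then nX else nS) k)%N -> measurable A ->
    Pr (xi (b, k, i) @^-1` A) = PZ A) /\
  (forall i j A B, (i < (if b then nX else nS) k)%N -> (j < (if b then nX else nS) k)%N ->
    i != j -> measurable A -> measurable B ->
    (Pr (xi (b, k, i) @^-1` A `&` xi (b, k, j) @^-1` B) =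
     Pr (xi (b, k, i) @^-1` A) * Pr (xi (b, k, j) @^-1` B))%E).
Proof.
split; first by move=> i ik; exact: Hxi_meas.
split; first by move=> i A ik; exact: Hxi_dist.
move=> i j A B ik jk ij mA mB.
apply: (cylinders_independent Hxi_indep (U1 := [set (b, k, i)]) (U2 := [set (b, k, j)])).
- by move=> _ ->.
- by move=> _ ->.
- apply/disj_set2P/seteqP; split => // p [-> [E]].
  by move: ij; rewrite E eqxx.
- exact: cylinders_preimage.
- exact: cylinders_preimage.
Qed.

(** The outcome is doubled: [s] enters only through the iterate and [t] only through the fresh
    draws. The actual deviation is the diagonal [s = t], the shape that [freezing] expects. *)
Let hess_dev k s t :=
  norm2 ((hessS H (nS k) (fun i => xiS k i t) (W k s) - HF (W k s)) *m (W k s - wstar)).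
Let grad_dev k s t :=
  norm2 (gradS g (nX k) (fun i => xiX k i t) (W k s) - gF (W k s)).

Section OneStep.
Variable k : nat.
Let T1 := g_sigma_algebraType (cylinders xi (past k)).
Let T2 b := g_sigma_algebraType (cylinders xi (block b k)).

Let measurable_iterate1 b i :
  measurable_fun setT (fun z : T1 * T2 b => W k z.1 i 0).
Proof. exact: (@measurableT_comp _ _ _ _ T1 _ (fun t : T1 => W k t i 0) _ fst). Qed.

Let measurable_block b l : (l < (if b then nX else nS) k)%N ->
  measurable_fun setT (fun z : T1 * T2 b => xi (b, k, l) z.2).
Proof.
move=> lk; apply: (@measurableT_comp _ _ _ _ (T2 b) _ (xi (b, k, l)) _ snd) => //.
exact: measurable_cylinders.
Qed.

Let measurable_hess_dev :
  measurable_fun setT (fun z : T1 * T2 false => hess_dev k z.1 z.2).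
Proof.
apply: measurable_norm2 => i; apply: measurable_mulmx => {i} [i j|i j].
  under eq_fun do rewrite mxE [X in _ + X]mxE.
  apply: measurable_funB; last first.
    apply: (measurable_fun_caratheodory (w := fun z : T1 * T2 false => W k z.1)
      (phi := fun q _ => HF q i j)) => // t q.
    apply: (@continuous_comp _ _ _ HF (fun A : 'M[R]_d => A i j)).
      exact: HHF_cont.
    exact: coord_continuous.
  apply: (measurable_hessS dg gH Hg_meas (w := fun z : T1 * T2 false => W k z.1)
    (xi := fun l (z : T1 * T2 false) => xiS k l z.2)) => // l lk.
  exact: (@measurable_block false).
rewrite (ord1 j); under eq_fun do rewrite !mxE.
by apply: measurable_funB => //; exact: measurable_cst.
Qed.

Let measurable_grad_dev :
  measurable_fun setT (fun z : T1 * T2 true => grad_dev k z.1 z.2).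
Proof.
apply: measurable_norm2 => i; under eq_fun do rewrite mxE [X in _ + X]mxE.
apply: measurable_funB; last first.
  apply: (measurable_fun_caratheodory (w := fun z : T1 * T2 true => W k z.1)
    (phi := fun q _ => gF q i 0)) => // t q.
  apply: (@continuous_comp _ _ _ gF (fun x : 'cV[R]_d => x i 0)); last exact: coord_continuous.
  by apply: differentiable_continuous; case: (HgF_diff q).
apply: (measurable_gradS dg Hg_meas (w := fun z : T1 * T2 true => W k z.1)
  (xi := fun l (z : T1 * T2 true) => xiX k l z.2)) => // l lk.
exact: (@measurable_block true).
Qed.

Let expected_hess_dev : (\int[Pr]_t (hess_dev k t t)%:E <=
  \int[Pr]_t (sigma / Num.sqrt (nS k)%:R * err k t)%:E)%E.
Proof.
apply: (freezing Hxi_meas Hxi_indep (@past_valid k) (@block_valid false k)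
  (past_block false k) measurable_hess_dev).
- by move=> s t; exact: norm2_ge0.
- apply: measurable_funM; first exact: measurable_cst.
  apply: measurable_norm2 => i; under eq_fun do rewrite !mxE.
  by apply: measurable_funB => //; exact: measurable_cst.
move=> s; have [mX [lX iX]] := law_indep false k.
exact: (sampled_hessian_error (HnS_pos k) mX lX iX _ (HH_meas _) (H_sym _) (H_ge0 _)
  (HA1L _) (HH_unb _) Hsigma (HA4 _)).
Qed.

Let expected_grad_dev : (\int[Pr]_t (grad_dev k t t)%:E <=
  (v / Num.sqrt (nX k)%:R)%:E)%E.
Proof.
have -> : ((v / Num.sqrt (nX k)%:R)%:E =
    \int[Pr]_t ((fun=> v / Num.sqrt (nX k)%:R) t)%:E)%E.
  by rewrite integral_cst//= [X in (_ * X)%E](_ : _ = 1%E) ?mule1//; exact: probability_setT.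
apply: (freezing Hxi_meas Hxi_indep (@past_valid k) (@block_valid true k)
  (past_block true k) measurable_grad_dev).
- by move=> s t; exact: norm2_ge0.
- exact: measurable_cst.
move=> s; have [mX [lX iX]] := law_indep true k.
exact: (sampled_gradient_error (HnX_pos k) mX lX iX (Hg_meas _) (Hg_unb _) Hv (HA2 _)).
Qed.

(** Both generated sigma-algebras are coarser than that of [Omega], so the diagonal map into their
    product is measurable. *)
Let measurable_diag b (phi : Omega -> Omega -> R) :
  measurable_fun setT (fun z : T1 * T2 b => phi z.1 z.2) ->
  measurable_fun setT (fun t => phi t t).
Proof.
move=> mphi.
have mid U : U `<=` valid ->
    measurable_fun setT (id : Omega -> g_sigma_algebraType (cylinders xi U)).
  by move=> UV _ A sA; rewrite setTI; exact: (cylinders_sigma_measurable Hxi_meas UV).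
apply: (measurableT_comp mphi (g := fun t : Omega => (t, t) : T1 * T2 b)).
by apply: measurable_fun_pair; apply: mid; [exact: past_valid | exact: block_valid].
Qed.

(** Stated in extended reals because finiteness of the moments is not known yet; it follows later by
    induction with B1. The inverse Hessian is bounded surely, so the two deviations are averaged
    separately. *)
Lemma expected_step :
  (\int[Pr]_t (err k.+1 t)%:E <= (mubar^-1)%:E *
    ((sigma / Num.sqrt (nS k)%:R)%:E * \int[Pr]_t (err k t)%:E +
     (M / 2)%:E * \int[Pr]_t (err k t ^+ 2)%:E +
     (v / Num.sqrt (nX k)%:R)%:E))%E.
Proof.
have mh := measurable_diag measurable_hess_dev.
have mgd := measurable_diag measurable_grad_dev.
have mu0 : 0 <= mubar^-1 by rewrite invr_ge0 ltW.
have h0 t : (0 <= (hess_dev k t t)%:E)%E by rewrite lee_fin norm2_ge0.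
have g0 t : (0 <= (grad_dev k t t)%:E)%E by rewrite lee_fin norm2_ge0.
have e0 t : (0 <= (err k t)%:E)%E by rewrite lee_fin norm2_ge0.
have q0 t : (0 <= (err k t ^+ 2)%:E)%E by rewrite lee_fin exprn_ge0// norm2_ge0.
have M2 : 0 <= M / 2 by rewrite divr_ge0.
have mE := measurable_err k.
have mE2 : measurable_fun setT (fun t => (err k t ^+ 2)%:E).
  by apply/measurable_EFinP; exact: measurable_funX.
pose bd t : \bar R := ((hess_dev k t t)%:E + (M / 2)%:E * (err k t ^+ 2)%:E +
  (grad_dev k t t)%:E)%E.
have mb1 : measurable_fun setT (fun t => (M / 2)%:E * (err k t ^+ 2)%:E)%E.
  exact: emeasurable_funM.
have mb2 : measurable_fun setT
    (fun t => (hess_dev k t t)%:E + (M / 2)%:E * (err k t ^+ 2)%:E)%E.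
  by apply: emeasurable_funD => //; exact/measurable_EFinP.
have mbd : measurable_fun setT bd.
  by apply: emeasurable_funD => //; exact/measurable_EFinP.
have b1 t : (0 <= (M / 2)%:E * (err k t ^+ 2)%:E)%E by apply: mule_ge0 => //; rewrite lee_fin.
apply: (@le_trans _ _ (\int[Pr]_t ((mubar^-1)%:E * bd t))%E).
  apply: ge0_le_integral => //.
  - by move=> t _; rewrite lee_fin norm2_ge0.
  - exact/measurable_EFinP/measurable_err.
  - exact: emeasurable_funM.
  move=> t _.
  have -> : ((mubar^-1)%:E * bd t = (mubar^-1 * (hess_dev k t t +
    M / 2 * err k t ^+ 2 + grad_dev k t t))%:E)%E by [].
  rewrite lee_fin [err k.+1 t]/=.
  apply: le_trans (newton_step_error (HF (W k t)) _ _ _ (gF (W k t)) Hmubar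
    (HA1S _ _ (HnS_pos k))) _.
  rewrite ler_pM2l ?invr_gt0// lerD2r lerD2l.
  have := gradient_taylor_le (W k t) wstar (fun w => (HgF_diff w).2) HA3.
  by rewrite gF_star subr0.
rewrite ge0_integralZl_EFin//; last first.
  by move=> t _; rewrite /bd !adde_ge0.
apply: lee_wpmul2l; first by rewrite lee_fin.
rewrite /bd ge0_integralD//; last 2 first.
- by move=> t _; rewrite adde_ge0.
- exact/measurable_EFinP.
apply: leeD => //.
rewrite ge0_integralD//; last exact/measurable_EFinP.
apply: leeD; last by rewrite ge0_integralZl_EFin.
apply: le_trans expected_hess_dev _.
under eq_integral do rewrite EFinM.
rewrite ge0_integralZl_EFin//; first exact/measurable_EFinP.
by rewrite divr_ge0// sqrtr_ge0.
Qed.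

End OneStep.
End ExpectedStep.

(** * R-superlinear convergence *)

Theorem theorem2p4
  (R : realType) (d : nat) (dO dZ : measure_display)
  (Omega : measurableType dO) (Z : measurableType dZ)
  (Pr : probability Omega R) (PZ : probability Z R)
  (f : 'cV[R]_d -> Z -> R) (g : 'cV[R]_d -> Z -> 'cV[R]_d)
  (H : 'cV[R]_d -> Z -> 'M[R]_d)
  (F : 'cV[R]_d -> R) (gF : 'cV[R]_d -> 'cV[R]_d) (HF : 'cV[R]_d -> 'M[R]_d)
  (wstar w0 : 'cV[R]_d)
  (nX nS : nat -> nat) (xiX xiS : nat -> nat -> Omega -> Z)
  (mu L mubar Lbar v M sigma gamma : R) (muB LB eta : nat -> R)
  (* setting: gradient g and Hessian H of f(.; z) *)
  (Hf_diff : forall z w, differentiable (f^~ z) w /\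
       forall u, is_derive w u (f^~ z) (dotv (g w z) u))
  (Hg_diff : forall z w, differentiable (g^~ z) w /\
       forall u, is_derive w u (g^~ z) (H w z *m u))
  (Hf_meas : forall w, measurable_fun setT (f w))
  (Hg_meas : forall w i, measurable_fun setT (fun z => g w z i 0))
  (HH_meas : forall w i j, measurable_fun setT (fun z => H w z i j))
  (* F(w) = E[f(w; x, y)]; grad/Hessian of F_i are unbiased *)
  (HF_def : forall w, (\int[PZ]_z (f w z)%:E = (F w)%:E)%E)
  (Hg_unb : forall w i, (\int[PZ]_z (g w z i 0)%:E = (gF w i 0)%:E)%E)
  (HH_unb : forall w i j, (\int[PZ]_z (H w z i j)%:E = (HF w i j)%:E)%E)
  (* w* is the unique minimizer of F *)
  (Hwstar_min : forall w, F wstar <= F w)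
  (Hwstar_uniq : forall w', (forall w, F w' <= F w) -> w' = wstar)
  (* the samples X_k = {xiX k i | i < nX k}, S_k = {xiS k i | i < nS k}:
     nonempty, all drawn from PZ, and mutually independent *)
  (HnX_pos : forall k, (0 < nX k)%N) (HnS_pos : forall k, (0 < nS k)%N)
  (Hxi_meas : forall (j : bool * nat * nat),
      (j.2 < (if j.1.1 then nX else nS) j.1.2)%N ->
      measurable_fun setT ((if j.1.1 then xiX else xiS) j.1.2 j.2))
  (Hxi_dist : forall (j : bool * nat * nat),
      (j.2 < (if j.1.1 then nX else nS) j.1.2)%N ->
      forall A, measurable A ->
      Pr (((if j.1.1 then xiX else xiS) j.1.2 j.2) @^-1` A) = PZ A)
  (Hxi_indep : mutually_independent Pr
      (fun j : bool * nat * nat => (if j.1.1 then xiX else xiS) j.1.2 j.2)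
      [set j | (j.2 < (if j.1.1 then nX else nS) j.1.2)%N])
  (* A1 *)
  (HF_diff : forall w, differentiable F w /\
       forall u, is_derive w u F (dotv (gF w) u))
  (HgF_diff : forall w, differentiable gF w /\
       forall u, is_derive w u gF (HF w *m u))
  (HHF_cont : continuous HF)
  (Hmubar : 0 < mubar)
  (HmuLB : forall beta, (0 < beta)%N ->
      [/\ 0 < muB beta, muB beta <= LB beta, mubar <= muB beta & LB beta <= Lbar])
  (HA1S : forall beta (zs : nat -> Z) w, (0 < beta)%N ->
      loewner_le (muB beta *: 1%:M) (hessS H beta zs w) /\
      loewner_le (hessS H beta zs w) (LB beta *: 1%:M))
  (HmuL : 0 < mu <= L)
  (HA1F : forall w, loewner_le (mu *: 1%:M) (HF w) /\ loewner_le (HF w) (L *: 1%:M))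
  (* A2 *)
  (Hv : 0 <= v)
  (HA2 : forall w, (trCov PZ (g w) <= (v ^+ 2)%:E)%E)
  (* A3 *)
  (HM : 0 <= M)
  (HA3 : forall w z, opnorm (HF w - HF z) <= M * norm2 (w - z))
  (* A4 *)
  (Hsigma : 0 <= sigma)
  (HA4 : forall w,
      opnorm (mexp PZ (fun z => (H w z - HF w) *m (H w z - HF w))) <= sigma ^+ 2)
  (* B1 *)
  (Hgamma : 0 < gamma)
  (HB1 : forall k,
      (\int[Pr]_om ((norm2 (sn_iter g H nX nS xiX xiS w0 k om - wstar)) ^+ 2)%:E
       <= gamma%:E *
          (\int[Pr]_om (norm2 (sn_iter g H nX nS xiX xiS w0 k om - wstar))%:E) ^+ 2)%E)
  (* (i) *)
  (HXk : forall k, (nX 0)%:R * eta k ^+ k <= (nX k)%:R)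
  (HX0 : ((6 * v * gamma * M) / mubar ^+ 2) ^+ 2 <= (nX 0)%:R)
  (Heta_incr : forall k, eta k < eta k.+1)
  (Heta_inf : eta @ \oo --> +oo)
  (Heta1 : 1 < eta 1)
  (* (ii) *)
  (HS_incr : forall k, (nS k < nS k.+1)%N)
  (HS_inf : (fun k => (nS k)%:R : R) @ \oo --> +oo)
  (HS0 : ((4 * sigma) / mubar) ^+ 2 <= (nS 0)%:R)
  (* initial point: ||w0 - w*|| <= mubar / (3 gamma M) *)
  (Hw0 : 3 * gamma * M * norm2 (w0 - wstar) <= mubar) :
  exists tau : nat -> R,
    [/\ forall k, 0 < tau k,
        forall k, (\int[Pr]_om (norm2 (sn_iter g H nX nS xiX xiS w0 k om - wstar))%:E
                   <= (tau k)%:E)%E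
      & (fun k => tau k.+1 / tau k) @ \oo --> (0 : R)].
Proof.
pose err k om := norm2 (sn_iter g H nX nS xiX xiS w0 k om - wstar).
have H_sym w z : (H w z)^T = H w z.
  apply: (@hessian_sym _ _ (f^~ z) (g^~ z) (H w z) w).
  - by move=> x u; case: (Hf_diff z x).
  - by case: (Hg_diff z w).
  - by move=> u; case: (Hg_diff z w).
have gF_star : gF wstar = 0.
  by apply: (gradient_at_min _ Hwstar_min) => w u; case: (HF_diff w).
have HA1S' n zs w : (0 < n)%N -> loewner_le (mubar *: 1%:M) (hessS H n zs w).
  move=> n0; have [_ _ mun _] := HmuLB n n0.
  by apply: (loewner_scalar_trans mun); case: (HA1S n zs w n0).
have HA1L w z : loewner_le (H w z) (LB 1%N *: 1%:M).
  have [_] := HA1S 1%N (fun=> z) w (ltn0Sn _).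
  by rewrite /hessS big_ord1 invr1 scale1r.
have step := expected_step w0 Hg_diff H_sym Hg_meas HH_meas Hg_unb HH_unb HnX_pos HnS_pos
  Hxi_meas Hxi_dist Hxi_indep HgF_diff HHF_cont gF_star Hmubar HA1S' HA1L Hv HA2 HM HA3
  Hsigma HA4.
have mu0 : 0 <= mubar^-1 by rewrite invr_ge0 ltW.
pose a k : R := fine (\int[Pr]_om (err k om)%:E)%E.
(* The factor [M / 2] of the Taylor term, the [gamma] of B1 that trades a second moment for a
   squared first one, and the bound [1 / mubar] on the inverse. *)
pose A : R := M * gamma / (2 * mubar).
pose s k : R := sigma / mubar / Num.sqrt (nS k)%:R.
pose c : R := v / mubar / Num.sqrt (nX 0)%:R.
(* A fourth root: the noise decays like [eta_k^(-k/2) = (e k ^+ k) ^+ 2], and the recursion compares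
   it with the slower [e k ^+ k]. *)
pose e k : R := (Num.sqrt (Num.sqrt (eta k)))^-1.
have int_ge0 k : (0 <= \int[Pr]_om (err k om)%:E)%E.
  by apply: integral_ge0 => om _; rewrite lee_fin norm2_ge0.
have a_ge0 k : 0 <= a k by exact: fine_ge0.
have a_step k : (\int[Pr]_om (err k om)%:E = (a k)%:E)%E ->
    (\int[Pr]_om (err k.+1 om)%:E <=
     (A * a k ^+ 2 + s k * a k + v / mubar / Num.sqrt (nX k)%:R)%:E)%E.
  move=> ak; apply: le_trans (step k) _.
  have -> : (A * a k ^+ 2 + s k * a k + v / mubar / Num.sqrt (nX k)%:R)%:E =
     ((mubar^-1)%:E * ((sigma / Num.sqrt (nS k)%:R)%:E * (a k)%:E +
      (M / 2)%:E * (gamma * a k ^+ 2)%:E + (v / Num.sqrt (nX k)%:R)%:E))%E.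
    transitivity ((mubar^-1 * (sigma / Num.sqrt (nS k)%:R * a k +
      M / 2 * (gamma * a k ^+ 2) + v / Num.sqrt (nX k)%:R))%:E); last by [].
    congr (_%:E).
    rewrite /A /s invfM; ring.
  apply: lee_wpmul2l; first by rewrite lee_fin.
  apply: leeD2r; apply: leeD.
    by rewrite [X in (_ * X <= _)%E]ak.
  apply: lee_wpmul2l; first by rewrite lee_fin divr_ge0.
  apply: le_trans (HB1 k) _.
  by rewrite [X in (_ * X ^+ 2 <= _)%E]ak -EFin_expe -EFinM.
have int0 : (\int[Pr]_om (err 0%N om)%:E = (norm2 (w0 - wstar))%:E)%E.
  transitivity (\int[Pr]_om (cst (norm2 (w0 - wstar))%:E om))%E; first by [].
  by rewrite integral_cst// [X in (_ * X)%E](_ : _ = 1%E) ?mule1//; exact: probability_setT.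
(* [fine] loses nothing: a finite first moment gives by B1 a finite second moment, hence a finite
   bound at the next step. *)
have aE k : (\int[Pr]_om (err k om)%:E = (a k)%:E)%E.
  elim: k => [|k ih].
    by rewrite /a int0.
  by rewrite /a fineK// ge0_fin_numE// (le_lt_trans (a_step _ ih))// ltry.
have a0E : a 0%N = norm2 (w0 - wstar).
  by apply: EFin_inj; rewrite -aE int0.
have eta_gt1 k : 1 < eta k.+1.
  by elim: k => // k /lt_trans; apply.
have A0 : 0 <= A by rewrite /A divr_ge0 ?mulr_ge0// ?ltW// mulr_gt0.
have X0pos : 0 < Num.sqrt (nX 0)%:R :> R by rewrite sqrtr_gt0 ltr0n.
have c_ge0 : 0 <= c by rewrite /c !divr_ge0// ltW.
have noise_le k : v / mubar / Num.sqrt (nX k)%:R <= c * (e k ^+ k) ^+ 2.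
  (* The case [k = 0] is separate because [eta 0] may be negative; both sides are then [1]. *)
  have -> : (e k ^+ k) ^+ 2 = (Num.sqrt (eta k ^+ k))^-1.
    case: k => [|k]; first by rewrite !expr0 sqrtr1 invr1 expr1n.
    have eta0 : 0 <= eta k.+1 by rewrite ltW// (lt_trans _ (eta_gt1 k)).
    by rewrite -exprM mulnC exprM exprVn sqr_sqrtr ?sqrtr_ge0// sqrtrX// exprVn.
  have etak : 0 < eta k ^+ k.
    by case: k => [|k]; rewrite ?expr0// exprn_gt0// (lt_trans _ (eta_gt1 k)).
  rewrite /c -[leRHS]mulrA -invfM -sqrtrM ?ler0n//.
  apply: ler_wpM2l; first by rewrite divr_ge0// ltW.
  rewrite lef_pV2 ?posrE ?sqrtr_gt0 ?mulr_gt0 ?ltr0n//.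
  exact: ler_wsqrtr.
have [tau [tau0 atau tau_cvg]] : exists tau : nat -> R,
    [/\ forall k, 0 < tau k, forall k, a k <= tau k &
        (fun k => tau k.+1 / tau k) @ \oo --> (0 : R)].
  apply: (@superlinear_recursion _ a s e A c) => //.
  - move=> k; rewrite -lee_fin -aE; apply: le_trans (a_step k (aE k)) _.
    by rewrite lee_fin lerD2l.
  (* The radius [mubar / (3 gamma M)] times [A = gamma M / (2 mubar)] is [1/6]. *)
  - rewrite a0E /A mulrAC ler_pdivrMr ?mulr_gt0//.
    by move: Hw0; lra.
  - have h : 6 * v * gamma * M / mubar ^+ 2 <= Num.sqrt (nX 0)%:R.
      apply: le_trans (ler_norm _) _; rewrite -sqrtr_sqr; exact: ler_wsqrtr.
    have -> : A * c = (6 * v * gamma * M / mubar ^+ 2) / Num.sqrt (nX 0)%:R / 12.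
      by rewrite /A /c; field; rewrite ?gt_eqF.
    have : (6 * v * gamma * M / mubar ^+ 2) / Num.sqrt (nX 0)%:R <= 1.
      by rewrite ler_pdivrMr// mul1r.
    by lra.
  - move=> k; have Sk : 0 < Num.sqrt (nS k)%:R :> R by rewrite sqrtr_gt0 ltr0n.
    apply/andP; split; first by rewrite /s !divr_ge0// ltW.
    rewrite /s ler_pdivrMr//.
    (* The threshold on [nS 0] passes to every [k] since [nS] increases; this gives [s k <= 1/4]. *)
    have h : 4 * sigma / mubar <= Num.sqrt (nS k)%:R.
      apply: le_trans (ler_norm _) _; rewrite -sqrtr_sqr; apply: ler_wsqrtr.
      apply: le_trans HS0 _; rewrite ler_nat.
      by elim: k {Sk} => // k ih; exact: leq_trans ih (ltnW (HS_incr k)).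
    by move: h; rewrite -mulrA; lra.
  - rewrite /s -[0](mulr0 (sigma / mubar)).
    apply: cvgM; first exact: cvg_cst.
    by apply: inv_cvgy0; exact: sqrt_cvgy.
  - by move=> k; rewrite invr_gt0 !sqrtr_gt0 (lt_trans _ (eta_gt1 k)).
  - have sqrt_gt1 (x : R) : 1 < x -> 1 < Num.sqrt x.
      by move=> x1; rewrite -[X in X < _]sqrtr1 ltr_sqrt// (lt_trans ltr01).
    by rewrite invf_lt1 ?sqrt_gt1// (lt_trans ltr01)// !sqrt_gt1.
  - move=> k; rewrite /e lef_pV2 ?posrE ?sqrtr_gt0 ?(lt_trans _ (eta_gt1 _))//.
    by apply: ler_wsqrtr; apply: ler_wsqrtr; exact: ltW.
  - by apply: inv_cvgy0; apply: sqrt_cvgy; exact: sqrt_cvgy.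
exists tau; split => // k.
by rewrite [leLHS]aE lee_fin.
Qed.
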